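(* Let $k$ be a field and $D$ a $k$-algebra with local units. Then $D$ is absolutely semisimple if and only if $D$ is Morita equivalent to $k_I$ for some (possibly infinite) set $I$.
   Context: All algebras are associative $k$-algebras, not necessarily unital. For a field extension $k\subseteq K$, $D_K=K\otimes_k D$ and $V_K = K\otimes_k V$. A $D$-module $V$ is unital if $V=DV:=\{\sum_i x_iv_i: x_i\in D, v_i\in V\}$. A $D$-module $V$ is simple if $DV\neq\{0\}$ and $\{0\}$, $V$ are its only submodules; absolutely simple if $V_K$ is a simple $D_K$-module for every field extension $k\subseteq K$; (absolutely) semisimple if it is a (possibly empty or infinite) direct sum of (absolutely) simple modules. The algebra $D$ is (absolutely) semisimple if every unital $D$-module is (absolutely) semisimple. $D$ has local units if for every finite subset $\{x_1,\dots,x_n\}\subseteq D$ there is an idempotent $e\in D$ with $ex_i=x_i=x_ie$ for all $i$. A $D$-module $V$ is firm if $D\otimes_D V\to V$, $d\otimes v\mapsto dv$, is an isomorphism; $D$ is firm if it is firm as a left module over itself. A Morita context consists of $k$-vector spaces $A_{ij}$, $i,j\in\{1,2\}$, with bilinear maps $A_{ij}\times A_{jl}\to A_{il}$ satisfying $(xy)z=x(yz)$ for all composable triples; it is a Morita context between $D=A_{11}$ and $E=A_{22}$. It is strict if all multiplication maps $A_{ij}\otimes_{A_{jj}}A_{ji}\to A_{ii}$ are isomorphisms. Firm algebras $D,E$ are Morita equivalent if there is a strict Morita context between them. $k_I=\bigoplus_{i\in I}k$ is the algebra of finitely supported $k$-valued functions on $I$ with pointwise operations. *)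

(* Defs.v *)
From HB Require Import structures.
From mathcomp Require Import all_boot all_order all_algebra.
From Stdlib Require Import ClassicalEpsilon FunctionalExtensionality ProofIrrelevance.

Set Implicit Arguments.
Unset Strict Implicit.
Unset Printing Implicit Defensive.

Import GRing.Theory.
Local Open Scope ring_scope.

Record nuAlg (k : fieldType) := NuAlg {
  alg_car :> lmodType k;
  amul : alg_car -> alg_car -> alg_car;
  amulA : forall x y z, amul (amul x y) z = amul x (amul y z);
  amulDl : forall x y z, amul (x + y) z = amul x z + amul y z;
  amulDr : forall x y z, amul x (y + z) = amul x y + amul x z;
  amulZl : forall (c : k) x y, amul (c *: x) y = c *: amul x y;
  amulZr : forall (c : k) x y, amul x (c *: y) = c *: amul x y
}.

Record amodule (k : fieldType) (D : nuAlg k) := AModule {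
  mod_car :> lmodType k;
  mact : D -> mod_car -> mod_car;
  mactA : forall x y v, mact (amul x y) v = mact x (mact y v);
  mactDl : forall x y v, mact (x + y) v = mact x v + mact y v;
  mactDr : forall x v w, mact x (v + w) = mact x v + mact x w;
  mactZl : forall (c : k) x v, mact (c *: x) v = c *: mact x v;
  mactZr : forall (c : k) x v, mact x (c *: v) = c *: mact x v
}.

Definition has_local_units (k : fieldType) (D : nuAlg k) : Prop :=
  forall s : seq D, exists e : D,
    amul e e = e /\ forall x, x \in s -> amul e x = x /\ amul x e = x.

Definition unital_mod (k : fieldType) (D : nuAlg k) (V : amodule D) : Prop :=
  forall v : V, exists s : seq (D * V),
    v = \sum_(p <- s) mact p.1 p.2.

Definition subspace (F : fieldType) (W : lmodType F) (P : W -> Prop) : Prop :=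
  P 0 /\ (forall u v, P u -> P v -> P (u + v)) /\
  (forall (a : F) v, P v -> P (a *: v)).

Definition simple_ops (F : fieldType) (A : Type) (W : lmodType F)
    (rho : A -> W -> W) : Prop :=
  (exists a w, rho a w <> 0) /\
  forall P : W -> Prop, subspace P -> (forall a w, P w -> P (rho a w)) ->
    (forall w, P w -> w = 0) \/ (forall w, P w).

Definition simple_mod (k : fieldType) (D : nuAlg k) (V : amodule D) : Prop :=
  simple_ops (@mact k D V).

Definition Klinear (K : fieldType) (W1 W2 : lmodType K) (g : W1 -> W2) : Prop :=
  (forall u v, g (u + v) = g u + g v) /\ (forall (a : K) v, g (a *: v) = a *: g v).

Definition ext_linear (k K : fieldType) (phi : {rmorphism k -> K})
    (V : lmodType k) (W : lmodType K) (f : V -> W) : Prop :=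
  (forall u v, f (u + v) = f u + f v) /\
  (forall (c : k) v, f (c *: v) = phi c *: f v).

(* (T, iota) is a scalar extension K (x)_k V (via phi : k -> K),
   i.e. iota : V -> T, v |-> 1 (x) v, is universal among k-linear maps
   from V into K-vector spaces. *)
Definition is_scalar_ext (k K : fieldType) (phi : {rmorphism k -> K})
    (V : lmodType k) (T : lmodType K) (iota : V -> T) : Prop :=
  ext_linear phi iota /\
  forall (W : lmodType K) (f : V -> W), ext_linear phi f ->
    (exists g : T -> W, Klinear g /\ forall v, g (iota v) = f v) /\
    (forall g1 g2 : T -> W, Klinear g1 -> Klinear g2 ->
       (forall v, g1 (iota v) = g2 (iota v)) -> forall t, g1 t = g2 t).

(* V is absolutely simple: for every field extension phi : k -> K,
   V_K = K (x)_k V is a simple D_K-module.  The D_K = K (x)_k D action on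
   V_K is (a (x) d)(b (x) v) = ab (x) dv, so D_K-submodules of V_K are the
   K-subspaces stable under the K-linear operators rho d = id_K (x) (d.-),
   d in D (which are characterised by rho d (1 (x) v) = 1 (x) dv). *)
Definition abs_simple_mod (k : fieldType) (D : nuAlg k) (V : amodule D) : Prop :=
  forall (K : fieldType) (phi : {rmorphism k -> K}) (T : lmodType K)
         (iota : V -> T),
    is_scalar_ext phi iota ->
    forall rho : D -> T -> T,
      (forall d, Klinear (rho d) /\ forall v, rho d (iota v) = iota (mact d v)) ->
      simple_ops rho.

Definition mod_morph (k : fieldType) (D : nuAlg k) (S V : amodule D)
    (f : S -> V) : Prop :=
  (forall u v, f (u + v) = f u + f v) /\
  (forall (c : k) v, f (c *: v) = c *: f v) /\
  (forall x v, f (mact x v) = mact x (f v)).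

Definition direct_sum_of (k : fieldType) (D : nuAlg k)
    (Q : amodule D -> Prop) (V : amodule D) : Prop :=
  exists (I : Type) (S : I -> amodule D) (e : forall i, S i -> V),
    (forall i, Q (S i)) /\
    (forall i, mod_morph (e i) /\ injective (e i)) /\
    (forall v : V, exists s : seq {i : I & S i},
        v = \sum_(p <- s) e (projT1 p) (projT2 p)) /\
    (forall s : seq {i : I & S i}, List.NoDup (map (@projT1 _ _) s) ->
        \sum_(p <- s) e (projT1 p) (projT2 p) = 0 ->
        forall p, List.In p s -> projT2 p = 0).

Definition semisimple_mod (k : fieldType) (D : nuAlg k) (V : amodule D) : Prop :=
  direct_sum_of (@simple_mod k D) V.

Definition abs_semisimple_mod (k : fieldType) (D : nuAlg k) (V : amodule D) : Prop :=
  direct_sum_of (@abs_simple_mod k D) V.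

Definition abs_semisimple_alg (k : fieldType) (D : nuAlg k) : Prop :=
  forall V : amodule D, unital_mod V -> abs_semisimple_mod V.

Definition klinear (k : fieldType) (V W : lmodType k) (g : V -> W) : Prop :=
  (forall u v, g (u + v) = g u + g v) /\ (forall (c : k) v, g (c *: v) = c *: g v).

Definition bilin (k : fieldType) (M N P : lmodType k) (f : M -> N -> P) : Prop :=
  (forall x1 x2 y, f (x1 + x2) y = f x1 y + f x2 y) /\
  (forall x y1 y2, f x (y1 + y2) = f x y1 + f x y2) /\
  (forall (c : k) x y, f (c *: x) y = c *: f x y) /\
  (forall (c : k) x y, f x (c *: y) = c *: f x y).

(* The map M (x)_R N -> P, x (x) y |-> mu x y, is an isomorphism, where
   M is a right R-module (via ra) and N a left R-module (via la).
   Equivalently (universal property of the balanced tensor product):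
   every k-bilinear R-balanced map f : M x N -> W factors uniquely as
   g o mu with g : P -> W k-linear. *)
Definition tensor_iso (k : fieldType) (R : Type) (M N P : lmodType k)
    (ra : M -> R -> M) (la : R -> N -> N) (mu : M -> N -> P) : Prop :=
  forall (W : lmodType k) (f : M -> N -> W),
    bilin f -> (forall x r y, f (ra x r) y = f x (la r y)) ->
    (exists g : P -> W, klinear g /\ forall x y, g (mu x y) = f x y) /\
    (forall g1 g2 : P -> W, klinear g1 -> klinear g2 ->
       (forall x y, g1 (mu x y) = g2 (mu x y)) -> forall p, g1 p = g2 p).

(* A Morita context between D = A11 and E = A22: spaces A12 = M12,
   A21 = M21 and bilinear maps A_ij x A_jl -> A_il
   (A11 x A11 -> A11 and A22 x A22 -> A22 being the multiplications of D, E):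
     l12 : A11 x A12 -> A12    r12 : A12 x A22 -> A12
     l21 : A22 x A21 -> A21    r21 : A21 x A11 -> A21
     p1  : A12 x A21 -> A11    p2  : A21 x A12 -> A22
   with (xy)z = x(yz) for all composable triples. *)
Record morita_ctx (k : fieldType) (D E : nuAlg k) := MoritaCtx {
  M12 : lmodType k;
  M21 : lmodType k;
  l12 : D -> M12 -> M12;
  r12 : M12 -> E -> M12;
  l21 : E -> M21 -> M21;
  r21 : M21 -> D -> M21;
  p1 : M12 -> M21 -> D;
  p2 : M21 -> M12 -> E;
  l12_bilin : bilin l12;
  r12_bilin : bilin r12;
  l21_bilin : bilin l21;
  r21_bilin : bilin r21;
  p1_bilin : bilin p1;
  p2_bilin : bilin p2;
  (* associativity for the index quadruples (i,j,l,m);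
     1111 and 2222 are the associativity of D and E *)
  as1112 : forall (x y : D) (z : M12), l12 (amul x y) z = l12 x (l12 y z);
  as1121 : forall (x : D) (y : M12) (z : M21), p1 (l12 x y) z = amul x (p1 y z);
  as1122 : forall (x : D) (y : M12) (z : E), r12 (l12 x y) z = l12 x (r12 y z);
  as1211 : forall (x : M12) (y : M21) (z : D), amul (p1 x y) z = p1 x (r21 y z);
  as1212 : forall (x : M12) (y : M21) (z : M12), l12 (p1 x y) z = r12 x (p2 y z);
  as1221 : forall (x : M12) (y : E) (z : M21), p1 (r12 x y) z = p1 x (l21 y z);
  as1222 : forall (x : M12) (y z : E), r12 (r12 x y) z = r12 x (amul y z);
  as2111 : forall (x : M21) (y z : D), r21 (r21 x y) z = r21 x (amul y z);
  as2112 : forall (x : M21) (y : D) (z : M12), p2 (r21 x y) z = p2 x (l12 y z);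
  as2121 : forall (x : M21) (y : M12) (z : M21), l21 (p2 x y) z = r21 x (p1 y z);
  as2122 : forall (x : M21) (y : M12) (z : E), amul (p2 x y) z = p2 x (r12 y z);
  as2211 : forall (x : E) (y : M21) (z : D), r21 (l21 x y) z = l21 x (r21 y z);
  as2212 : forall (x : E) (y : M21) (z : M12), p2 (l21 x y) z = amul x (p2 y z);
  as2221 : forall (x y : E) (z : M21), l21 (amul x y) z = l21 x (l21 y z)
}.

Definition strict_ctx (k : fieldType) (D E : nuAlg k) (C : morita_ctx D E) : Prop :=
  tensor_iso (@amul k D) (@amul k D) (@amul k D) /\
  tensor_iso (@r12 k D E C) (@l21 k D E C) (@p1 k D E C) /\
  tensor_iso (@r21 k D E C) (@l12 k D E C) (@p2 k D E C) /\
  tensor_iso (@amul k E) (@amul k E) (@amul k E).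

Definition morita_equiv (k : fieldType) (D E : nuAlg k) : Prop :=
  exists C : morita_ctx D E, strict_ctx C.

Record finsupp (k : fieldType) (I : Type) := FinSupp {
  fs_fun :> I -> k;
  fs_supp : exists s : seq I, forall i, fs_fun i <> 0 -> List.In i s
}.

Lemma finsupp_ext (k : fieldType) (I : Type) (f g : finsupp k I) :
  (forall i, f i = g i) -> f = g.
Proof.
case: f g => f Hf [g Hg] /= E.
have efg : f = g by apply: functional_extensionality.
subst g; congr FinSupp; apply: proof_irrelevance.
Qed.

Definition fs_eqb (k : fieldType) (I : Type) (f g : finsupp k I) : bool :=
  if excluded_middle_informative (f = g) then true else false.

Lemma fs_eqP (k : fieldType) (I : Type) : Equality.axiom (@fs_eqb k I).
Proof.
move=> f g; rewrite /fs_eqb; case: excluded_middle_informative => H.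
  by apply: ReflectT. by apply: ReflectF.
Qed.

HB.instance Definition _ (k : fieldType) (I : Type) :=
  hasDecEq.Build (finsupp k I) (@fs_eqP k I).

Definition fs_find (k : fieldType) (I : Type) (P : pred (finsupp k I)) (n : nat)
  : option (finsupp k I) :=
  match excluded_middle_informative (exists x, P x) with
  | left H => Some (proj1_sig (constructive_indefinite_description _ H))
  | right _ => None
  end.

Lemma fs_find_correct (k : fieldType) (I : Type) (P : pred (finsupp k I)) n x :
  fs_find P n = Some x -> P x.
Proof.
rewrite /fs_find; case: excluded_middle_informative => // H [<-].
exact: proj2_sig (constructive_indefinite_description _ H).
Qed.

Lemma fs_find_complete (k : fieldType) (I : Type) (P : pred (finsupp k I)) :
  (exists x, P x) -> exists n, fs_find P n.
Proof.
move=> H; exists 0%N; rewrite /fs_find; case: excluded_middle_informative => //.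
Qed.

Lemma fs_find_ext (k : fieldType) (I : Type) (P Q : pred (finsupp k I)) :
  P =1 Q -> fs_find P =1 fs_find Q.
Proof.
move=> E n; have -> : P = Q by apply: functional_extensionality.
by [].
Qed.

HB.instance Definition _ (k : fieldType) (I : Type) :=
  hasChoice.Build (finsupp k I) (@fs_find_correct k I)
    (@fs_find_complete k I) (@fs_find_ext k I).

Lemma fs_zero_supp (k : fieldType) (I : Type) :
  exists s : seq I, forall i, (fun _ : I => (0 : k)) i <> 0 -> List.In i s.
Proof. by exists [::] => i. Qed.

Definition fs_zero (k : fieldType) (I : Type) : finsupp k I :=
  FinSupp (@fs_zero_supp k I).

Lemma fs_binop_supp (k : fieldType) (I : Type) (op : k -> k -> k)
    (op0 : op 0 0 = 0) (f g : finsupp k I) :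
  exists s : seq I, forall i, op (f i) (g i) <> 0 -> List.In i s.
Proof.
case: (fs_supp f) => s Hs; case: (fs_supp g) => t Ht.
exists (s ++ t) => i Hi; apply/List.in_or_app.
case: (excluded_middle_informative (f i = 0)) => Hf; last by left; apply: Hs.
case: (excluded_middle_informative (g i = 0)) => Hg; last by right; apply: Ht.
by exfalso; apply: Hi; rewrite Hf Hg.
Qed.

Definition fs_add (k : fieldType) (I : Type) (f g : finsupp k I) : finsupp k I :=
  FinSupp (@fs_binop_supp k I +%R (addr0 0) f g).

Definition fs_mul (k : fieldType) (I : Type) (f g : finsupp k I) : finsupp k I :=
  FinSupp (@fs_binop_supp k I *%R (mulr0 0) f g).

Lemma fs_scale_supp (k : fieldType) (I : Type) (c : k) (f : finsupp k I) :
  exists s : seq I, forall i, c * f i <> 0 -> List.In i s.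
Proof.
case: (fs_supp f) => s Hs; exists s => i Hi; apply: Hs => Hf.
by apply: Hi; rewrite Hf mulr0.
Qed.

Definition fs_scale (k : fieldType) (I : Type) (c : k) (f : finsupp k I) : finsupp k I :=
  FinSupp (@fs_scale_supp k I c f).

Definition fs_opp (k : fieldType) (I : Type) (f : finsupp k I) : finsupp k I :=
  fs_scale (-1) f.

Lemma fs_addA (k : fieldType) (I : Type) : associative (@fs_add k I).
Proof. by move=> f g h; apply: finsupp_ext => i /=; rewrite addrA. Qed.
Lemma fs_addC (k : fieldType) (I : Type) : commutative (@fs_add k I).
Proof. by move=> f g; apply: finsupp_ext => i /=; rewrite addrC. Qed.
Lemma fs_add0 (k : fieldType) (I : Type) : left_id (@fs_zero k I) (@fs_add k I).
Proof. by move=> f; apply: finsupp_ext => i /=; rewrite add0r. Qed.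
Lemma fs_addN (k : fieldType) (I : Type) :
  left_inverse (@fs_zero k I) (@fs_opp k I) (@fs_add k I).
Proof. by move=> f; apply: finsupp_ext => i /=; rewrite mulN1r addNr. Qed.

HB.instance Definition _ (k : fieldType) (I : Type) :=
  GRing.isZmodule.Build (finsupp k I) (@fs_addA k I) (@fs_addC k I)
    (@fs_add0 k I) (@fs_addN k I).

Lemma fs_scaleA (k : fieldType) (I : Type) (a b : k) (f : finsupp k I) :
  fs_scale a (fs_scale b f) = fs_scale (a * b) f.
Proof. by apply: finsupp_ext => i /=; rewrite mulrA. Qed.
Lemma fs_scale1 (k : fieldType) (I : Type) : left_id 1 (@fs_scale k I).
Proof. by move=> f; apply: finsupp_ext => i /=; rewrite mul1r. Qed.
Lemma fs_scaleDr (k : fieldType) (I : Type) :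
  right_distributive (@fs_scale k I) +%R.
Proof. by move=> a f g; apply: finsupp_ext => i /=; rewrite mulrDr. Qed.
Lemma fs_scaleDl (k : fieldType) (I : Type) (f : finsupp k I) :
  {morph (@fs_scale k I)^~ f : a b / a + b}.
Proof. by move=> a b; apply: finsupp_ext => i /=; rewrite mulrDl. Qed.

HB.instance Definition _ (k : fieldType) (I : Type) :=
  GRing.Zmodule_isLmodule.Build k (finsupp k I) (@fs_scaleA k I)
    (@fs_scale1 k I) (@fs_scaleDr k I) (@fs_scaleDl k I).

Lemma fs_mulA (k : fieldType) (I : Type) (f g h : finsupp k I) :
  fs_mul (fs_mul f g) h = fs_mul f (fs_mul g h).
Proof. by apply: finsupp_ext => i /=; rewrite mulrA. Qed.
Lemma fs_mulDl (k : fieldType) (I : Type) (f g h : finsupp k I) :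
  fs_mul (f + g) h = fs_mul f h + fs_mul g h.
Proof. by apply: finsupp_ext => i /=; rewrite mulrDl. Qed.
Lemma fs_mulDr (k : fieldType) (I : Type) (f g h : finsupp k I) :
  fs_mul f (g + h) = fs_mul f g + fs_mul f h.
Proof. by apply: finsupp_ext => i /=; rewrite mulrDr. Qed.
Lemma fs_mulZl (k : fieldType) (I : Type) (c : k) (f g : finsupp k I) :
  fs_mul (c *: f) g = c *: fs_mul f g.
Proof. by apply: finsupp_ext => i /=; rewrite mulrA. Qed.
Lemma fs_mulZr (k : fieldType) (I : Type) (c : k) (f g : finsupp k I) :
  fs_mul f (c *: g) = c *: fs_mul f g.
Proof. by apply: finsupp_ext => i /=; rewrite mulrCA. Qed.

Definition kI (k : fieldType) (I : Type) : nuAlg k :=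
  @NuAlg k (finsupp k I) (@fs_mul k I) (@fs_mulA k I) (@fs_mulDl k I)
    (@fs_mulDr k I) (@fs_mulZl k I) (@fs_mulZr k I).

(* Main.v *)
Require Import Defs.
From HB Require Import structures.
From mathcomp Require Import all_boot all_order all_algebra.
From mathcomp Require Import boolp classical_sets.

(** If D is strictly Morita equivalent to k_I through A12, A21, the elements
    p1 p q act on the column A12 e_i as rank one operators with values in k;
    local units turn finitely many of them into a dual basis, which survives
    any scalar extension, so the columns are absolutely simple.  A unital module
    is a sum of images of columns, hence a direct sum by Zorn's lemma.

    Conversely the left module D is a sum of absolutely simple left ideals; each
    of them is generated by an idempotent e, and eDe = ke: if y in eDe were not
    a scalar, then for a subfield K of eDe containing y the kernel of
    K (x) De -> De, a (x) s |-> sa, would be a proper nonzero submodule of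
    K (x) De.  Choosing one e per isomorphism class of simple modules De gives
    idempotents e_i with e_i D e_j = 0 for i <> j and D = sum D e_i D, so that
    k_I embeds in D, and A12 = sum D e_i, A21 = sum e_i D are subspaces of D with
    all multiplications induced by the one of D.  Surjectivity of p1 and p2
    together with local units makes this context strict. *)

Set Implicit Arguments.
Unset Strict Implicit.
Unset Printing Implicit Defensive.

Import GRing.Theory.
Local Open Scope ring_scope.
Local Open Scope quotient_scope.

(** * Subspaces, functionals and quotients *)

Section Subspace.
Variables (F : fieldType) (W : lmodType F) (P : W -> Prop) (HP : subspace P).

(** Excluded middle turns [P] into a boolean predicate. The proof of [subspace P] is an argument so
    that closure can be inferred from the term [mem_subspace HP] alone. *)
Definition mem_subspace of subspace P : {pred W} := fun w => `[< P w >].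

Lemma mem_subspace_closed : submod_closed (mem_subspace HP).
Proof.
case: HP => P0 [PD PZ]; split; first by apply/asboolP.
by move=> a u v /asboolP Pu /asboolP Pv; apply/asboolP/PD => //; apply: PZ.
Qed.

HB.instance Definition _ :=
  GRing.isSubmodClosed.Build F W (mem_subspace HP) mem_subspace_closed.

Record subsp := Subsp { subsp_val :> W; _ : subsp_val \in mem_subspace HP }.

HB.instance Definition _ := [isSub for subsp_val].
HB.instance Definition _ := [Choice of subsp by <:].
HB.instance Definition _ := [SubChoice_isSubLmodule of subsp by <:].

Lemma subspP (x : subsp) : P (val x).
Proof. by case: x => x /= /asboolP. Qed.

Lemma subsp_val_lin : Klinear (fun x : subsp => val x).
Proof. by []. Qed.

Definition to_subsp w (Pw : P w) : subsp := @Subsp w (introT (asboolP (P w)) Pw).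

End Subspace.

Lemma subspaceN (F : fieldType) (W : lmodType F) (P : W -> Prop) u :
  subspace P -> P u -> P (- u).
Proof. by case=> _ [_ PZ] Pu; rewrite -scaleN1r; apply: PZ. Qed.

Lemma subspaceB (F : fieldType) (W : lmodType F) (P : W -> Prop) u v :
  subspace P -> P u -> P v -> P (u - v).
Proof. by move=> HP Pu Pv; case: (HP) => _ [PD _]; apply: PD => //; apply: subspaceN. Qed.

Lemma subspace_sum (F : fieldType) (W : lmodType F) (P : W -> Prop)
    (T : Type) (s : seq T) (f : T -> W) :
  subspace P -> (forall x, List.In x s -> P (f x)) -> P (\sum_(x <- s) f x).
Proof.
move=> HP; case: (HP) => P0 [PD _].
elim: s => [|a s IH] Hs; first by rewrite big_nil.
rewrite big_cons; apply: PD; first by apply: Hs; left.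
by apply: IH => x xs; apply: Hs; right.
Qed.

Section Klin.
Variables (K : fieldType) (W1 W2 : lmodType K) (g : W1 -> W2).
Hypothesis g_lin : Klinear g.

Lemma Klinear0 : g 0 = 0.
Proof. by case: g_lin => _ gZ; rewrite -(scale0r (0 : W1)) gZ scale0r. Qed.

Lemma KlinearN u : g (- u) = - g u.
Proof. by case: g_lin => _ gZ; rewrite -scaleN1r gZ scaleN1r. Qed.

Lemma KlinearB u v : g (u - v) = g u - g v.
Proof. by case: (g_lin) => gD _; rewrite gD KlinearN. Qed.

Lemma Klinear_sum (T : Type) (s : seq T) (f : T -> W1) :
  g (\sum_(x <- s) f x) = \sum_(x <- s) g (f x).
Proof. by apply: big_morph; [case: g_lin | exact: Klinear0]. Qed.
End Klin.

(** Zorn's lemma gives a subspace [M] containing [U] and maximal among those that avoid [v]. Then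
    [W] is the direct sum of [M] and the line of [v], and [f] reads off the coordinate along [v]. *)
Lemma separating_functional (F : fieldType) (W : lmodType F) (U : W -> Prop) v :
  subspace U -> ~ U v ->
  exists f : W -> F^o, Klinear f /\ (forall u, U u -> f u = 0) /\ f v = 1.
Proof.
move=> HU Uv.
(* The sets A are united with U so that the empty chain is bounded. *)
have [C CF|M0 [[HM nMv] Mmax]] := @Zorn_bigcup W
  [set A | subspace (fun w => A w \/ U w) /\ ~ A v].
  move=> Ctot; split; last by move=> [A CA /= Av]; case: (CF _ CA) => _ /(_ Av).
  split; first by right; case: HU.
  split => [u w|a w].
    move=> [[A CA Au]|Uu] [[B CB Bw]|Uw].
    - case: (Ctot _ _ CA CB) => AB.
        case: (CF _ CB) => [[_ [BD _]] _].
        by case: (BD u w) => [|||]; [left; apply: AB| left| left; exists B| right].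
      case: (CF _ CA) => [[_ [BD _]] _].
      by case: (BD u w) => [|||]; [left| left; apply: AB| left; exists A| right].
    - case: (CF _ CA) => [[_ [BD _]] _].
      by case: (BD u w) => [|||]; [left|right|left; exists A|right].
    - case: (CF _ CB) => [[_ [BD _]] _].
      by case: (BD u w) => [|||]; [right|left|left; exists B|right].
    by right; case: HU => _ [UD _]; apply: UD.
  case=> [[A CA Aw]|Uw]; last by right; case: HU => _ [_ UZ]; apply: UZ.
  case: (CF _ CA) => [[_ [_ AZ]] _].
  by case: (AZ a w) => [||]; [left|left; exists A|right].
pose M w := M0 w \/ U w.
have Mv : ~ M v by case.
have MU u : U u -> M u by right.
have [Z0 [MD MZ]] := HM.
(* If [x] is outside [M], then by maximality [M + F x] contains [v], so [v - c x] is in [M]; here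
   [c] is nonzero because [v] is not in [M], and one solves for [x]. *)
have Mx x : exists c, M (x - c *: v).
  have [Mx|nMx] := EM (M x); first by exists 0; rewrite scale0r subr0.
  pose B w := exists c, M (w - c *: x).
  have MB w : M w -> B w by exists 0; rewrite scale0r subr0.
  have HB : subspace B.
    split; [by exists 0; rewrite scale0r subr0|split].
      move=> u w [a Ha] [b Hb]; exists (a + b).
      by rewrite scalerDl opprD addrACA; apply: MD.
    by move=> a w [b Hb]; exists (a * b); rewrite -scalerA -scalerBr; apply: MZ.
  have : ~ ~ B v.
    move=> nBv; apply: (Mmax B).
      split; first by move=> w Mw; apply: MB; left.
      by move=> BM; apply: nMx; left; apply: BM; exists 1; rewrite scale1r subrr.
    split=> //.
    rewrite (_ : (fun w => B w \/ U w) = B) //.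
    apply/funext => w; apply/propext; split; last by left.
    by case=> // /MU /MB.
  move=> /contrapT [c Hc].
  have c0 : c != 0.
    by apply/eqP => c0; move: Hc; rewrite c0 scale0r subr0.
  exists c^-1; rewrite (_ : _ - _ = - (c^-1 *: (v - c *: x))).
    by apply: (subspaceN HM); apply: MZ.
  by rewrite scalerBr scalerA mulVf // scale1r opprB.
have [f Hf] := choice Mx.
(* Two such coordinates differ by a scalar [d] with [d v] in [M], which forces [d = 0]. Linearity of
   [f] follows from this uniqueness. *)
have fE x c : M (x - c *: v) -> f x = c.
  move=> Hc; apply/eqP; rewrite -subr_eq0; apply: contraT => d0; exfalso.
  apply: Mv; have := MZ (f x - c)^-1 _ (subspaceB HM Hc (Hf x)).
  rewrite (_ : _ - _ - _ = (f x - c) *: v).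
    by rewrite scalerA mulVf // scale1r.
  by rewrite scalerBl opprB addrC addrA subrK.
exists f; split; [split|split].
- move=> u w; apply: fE; rewrite scalerDl opprD addrACA.
  exact: MD (Hf u) (Hf w).
- move=> a u; apply: (fE _ (a * f u)); rewrite -scalerA -scalerBr.
  exact: (MZ _ _ (Hf u)).
- by move=> u /MU Mu; apply: fE; rewrite scale0r subr0.
- by apply: fE; rewrite scale1r subrr.
Qed.

(** Converts the uniqueness half of a universal property into generation: uniqueness shows that a
    functional vanishing on the generators is zero. *)
Lemma full_subspace (F : fieldType) (W : lmodType F) (U : W -> Prop) :
  subspace U ->
  (forall f : W -> F^o, Klinear f -> (forall u, U u -> f u = 0) ->
     forall w, f w = 0) ->
  forall w, U w.
Proof.
move=> HU H w; apply: contrapT => /(separating_functional HU) [f [fl [f0 f1]]].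
by have := H f fl f0 w; rewrite f1 => /eqP; rewrite oner_eq0.
Qed.

Section QuotientSpace.
Variables (F : fieldType) (W : lmodType F) (U : W -> Prop) (HU : subspace U).

Definition quotient_car := Quotient.quot (mem_subspace HU : zmodClosed W).

Local Notation Q := quotient_car.

HB.instance Definition _ := GRing.Zmodule.on Q.

Definition quotient_scale (a : F) (x : Q) : Q := \pi_Q (a *: repr x).

Lemma quotient_eqP (x y : W) : U (x - y) <-> \pi_Q x = \pi_Q y.
Proof.
split; first by move=> Uxy; apply/eqP; rewrite -Quotient.idealrBE; apply/asboolP.
by move/eqP; rewrite -Quotient.idealrBE => /asboolP.
Qed.

Lemma quotient_scale_pi a x : quotient_scale a (\pi_Q x) = \pi_Q (a *: x).
Proof.
apply/quotient_eqP; rewrite -scalerBr; have [_ [_ UZ]] := HU; apply: UZ.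
by apply/quotient_eqP; rewrite reprK.
Qed.

Lemma quotient_scaleA a b x : quotient_scale a (quotient_scale b x) = quotient_scale (a * b) x.
Proof. by rewrite -[x]reprK (quotient_scale_pi b) (quotient_scale_pi a) scalerA (quotient_scale_pi (a * b)). Qed.

Lemma quotient_scale1 : left_id 1 quotient_scale.
Proof. by move=> x; rewrite -[x]reprK quotient_scale_pi scale1r. Qed.

Lemma quotient_scaleDr : right_distributive quotient_scale +%R.
Proof.
move=> a x y; rewrite -[x]reprK -[y]reprK -raddfD !quotient_scale_pi scalerDr.
by rewrite raddfD.
Qed.

Lemma quotient_scaleDl x : {morph quotient_scale^~ x : a b / a + b}.
Proof. by move=> a b; rewrite -[x]reprK !quotient_scale_pi scalerDl raddfD. Qed.

HB.instance Definition _ := GRing.Zmodule_isLmodule.Build F Q quotient_scaleA quotient_scale1 quotient_scaleDr quotient_scaleDl.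

Lemma quotient_space : exists (T : lmodType F) (p : W -> T),
  Klinear p /\ (forall t, exists w, p w = t) /\ (forall w, p w = 0 <-> U w).
Proof.
exists quotient_car, (\pi_Q : W -> quotient_car); split; [split|split].
- by move=> u v; exact: raddfD.
- by move=> c u; rewrite -quotient_scale_pi.
- by move=> t; exists (repr t); exact: reprK.
- move=> w; rewrite -{2}[w]subr0 quotient_eqP; have -> : \pi_Q 0 = 0 by exact: raddf0.
  by [].
Qed.

End QuotientSpace.

(** * Finitely supported functions and scalar extensions *)

Lemma In_mem (X : eqType) (x : X) (s : seq X) : List.In x s <-> x \in s.
Proof.
elim: s => [|a s IH] //=; rewrite inE; split.
  by case=> [->|/IH ->]; rewrite ?eqxx ?orbT.
by case/orP => [/eqP ->|/IH]; [left|right].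
Qed.

Section FsSum.
Variables (F : fieldType) (X : Type).

(** The support bound is only known to exist, so a list is chosen; it may also contain points where
    [t] vanishes. *)
Definition fs_dom (t : finsupp F X) : seq {classic X} :=
  undup (sval (cid (fs_supp t)) : seq {classic X}).

Lemma fs_dom_uniq t : uniq (fs_dom t).
Proof. exact: undup_uniq. Qed.

Lemma fs_domP (t : finsupp F X) (x : {classic X}) : t x <> 0 -> x \in fs_dom t.
Proof. by move=> tx; rewrite /fs_dom mem_undup; apply/In_mem; apply: (svalP (cid (fs_supp t))). Qed.

Lemma fs_ind_supp (s : seq {classic X}) :
  exists r : seq X, forall x, ((x \in s)%:R : F) <> 0 -> List.In x r.
Proof. by exists s => x; case: (boolP (x \in s)) => // /In_mem. Qed.

Definition fs_ind s : finsupp F X := FinSupp (fs_ind_supp s).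

Definition fs_delta (x : X) : finsupp F X := fs_ind [:: x].

Lemma fs_deltaE x y : fs_delta x y = ((y : {classic X}) == x)%:R.
Proof. by rewrite /= inE. Qed.

Lemma fs_indM s (t : finsupp F X) :
  {subset fs_dom t <= s} -> fs_mul (fs_ind s) t = t.
Proof.
move=> ts; apply: finsupp_ext => x /=.
have [->|/eqP tx] := eqVneq (t x) 0; first by rewrite mulr0.
by rewrite ts ?mul1r //; apply: fs_domP.
Qed.

Lemma fs_mulC (t u : finsupp F X) : fs_mul t u = fs_mul u t.
Proof. by apply: finsupp_ext => x /=; rewrite mulrC. Qed.

(** Here [finsupp F X] serves as the free vector space on [X] with basis [fs_delta], and [fs_sum f]
    is the linear extension of [f]. *)
Definition fs_sum (W : lmodType F) (f : X -> W) (t : finsupp F X) : W :=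
  \sum_(x <- fs_dom t) t x *: f x.

Variables (W : lmodType F) (f : X -> W).

(** The extra points contribute zero. Sums for several functions can thus be taken over one common
    list, which is how linearity is proved. *)
Lemma fs_sumE (s : seq {classic X}) (t : finsupp F X) :
  uniq s -> {subset fs_dom t <= s} -> fs_sum f t = \sum_(x <- s) t x *: f x.
Proof.
move=> us ts; rewrite /fs_sum.
have E (r : seq {classic X}) : \sum_(x <- r) t x *: f x = \sum_(x <- r | t x != 0) t x *: f x.
  by rewrite [RHS]big_mkcond; apply: eq_bigr => x _; case: eqP => // ->; rewrite scale0r.
rewrite E [RHS]E -big_filter -[RHS]big_filter; apply: perm_big; apply: uniq_perm.
- by rewrite filter_uniq ?fs_dom_uniq.
- by rewrite filter_uniq.
by move=> x; rewrite !mem_filter; case: eqP => //= tx; rewrite (ts x (fs_domP tx)) fs_domP.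
Qed.

Lemma fs_sum_lin : Klinear (fs_sum f).
Proof.
split=> [t u|a t].
  pose s := undup (fs_dom t ++ fs_dom u ++ fs_dom (t + u)).
  rewrite !(@fs_sumE s) ?undup_uniq //;
    try by move=> x xs; rewrite mem_undup !mem_cat xs ?orbT.
  by rewrite -big_split; apply: eq_bigr => x _ /=; rewrite -scalerDl.
pose s := undup (fs_dom t ++ fs_dom (a *: t)).
rewrite !(@fs_sumE s) ?undup_uniq //;
  try by move=> x xs; rewrite mem_undup !mem_cat xs ?orbT.
by rewrite scaler_sumr; apply: eq_bigr => x _; rewrite scalerA.
Qed.

Lemma fs_sum_delta (x : {classic X}) : fs_sum f (fs_delta x) = f x.
Proof.
rewrite (@fs_sumE (undup (x :: fs_dom (fs_delta x)))) ?undup_uniq //; last first.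
  by move=> y ys; rewrite mem_undup inE ys orbT.
set s := undup _; have xs : x \in s by rewrite mem_undup mem_head.
rewrite (big_rem x xs) fs_deltaE eqxx scale1r big_seq big1; first exact: addr0.
move=> y.
rewrite mem_rem_uniq ?undup_uniq // !inE fs_deltaE => /andP[/negbTE /= -> _].
by rewrite scale0r.
Qed.
End FsSum.

Lemma fs_eval_lin (F : fieldType) (X : Type) (x : X) :
  Klinear (fun t : finsupp F X => t x : F^o).
Proof. by []. Qed.

Lemma fs_expand (F : fieldType) (X : Type) (t : finsupp F X) :
  t = fs_sum (@fs_delta F X) t.
Proof.
suff E (x : {classic X}) : t x = fs_sum (@fs_delta F X) t x by exact: finsupp_ext.
rewrite (Klinear_sum (@fs_eval_lin F X x)).
have E y : (t y *: fs_delta F y : finsupp F X) x = t y * (x == y)%:R by rewrite -fs_deltaE.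
have [tx|/eqP tx] := eqVneq (t x) 0.
  rewrite tx big1 // => y _; rewrite E; case: eqP => [<-|_]; last by rewrite mulr0.
  by rewrite tx mul0r.
rewrite (big_rem x) ?fs_domP // E eqxx mulr1 big_seq big1; first exact/esym/addr0.
move=> y.
rewrite mem_rem_uniq ?fs_dom_uniq // !inE E => /andP[yx _].
by rewrite eq_sym (negbTE yx) mulr0.
Qed.

Lemma Klinear_fs (F : fieldType) (X : Type) (W : lmodType F)
    (g : finsupp F X -> W) :
  Klinear g -> forall t, g t = fs_sum (fun x => g (fs_delta F x)) t.
Proof.
move=> gl t; rewrite {1}[t]fs_expand (Klinear_sum gl).
by apply: eq_bigr => x _; case: gl => _ ->.
Qed.

(** * Construction of scalar extensions *)

Section ScalarExt.
Variables (k K : fieldType) (phi : {rmorphism k -> K}) (V : lmodType k).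

(* The common kernel of all the maps that have to factor through K (x) V;
   quotienting by it makes the existence half of universality immediate. *)
Let N (t : finsupp K V) :=
  forall (W : lmodType K) (f : V -> W), ext_linear phi f -> fs_sum f t = 0.

Let N_subspace : subspace N.
Proof.
split; first by move=> W f _; rewrite (Klinear0 (fs_sum_lin f)).
split=> [t u Nt Nu|a t Nt] W f fl; case: (fs_sum_lin f) => D Z.
  by rewrite D Nt // Nu // addr0.
by rewrite Z Nt // scaler0.
Qed.

Lemma scalar_ext_exists :
  exists (T : lmodType K) (iota : V -> T), is_scalar_ext phi iota.
Proof.
have [T [p [pl [psurj pker]]]] := quotient_space N_subspace.
have [pD pZ] := pl.
exists T, (fun v => p (fs_delta K v)); split; first split.
- move=> u v; rewrite -pD; apply/eqP; rewrite -subr_eq0 -(KlinearB pl); apply/eqP/pker.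
  move=> W f fl; have [D Z] := fs_sum_lin f; have [fD _] := fl.
  by rewrite (KlinearB (fs_sum_lin f)) D !fs_sum_delta fD subrr.
- move=> c v; rewrite -pZ; apply/eqP; rewrite -subr_eq0 -(KlinearB pl); apply/eqP/pker.
  move=> W f fl; have [D Z] := fs_sum_lin f; have [_ fZ] := fl.
  by rewrite (KlinearB (fs_sum_lin f)) Z !fs_sum_delta fZ subrr.
move=> W f fl; split.
  have [r rK] := choice psurj.
  (* The factorization is computed on a chosen lift [r t]; two lifts differ by an element of [N],
     which [fs_sum f] kills. *)
  have gE t u : p u = t -> fs_sum f (r t) = fs_sum f u.
    move=> pu; apply/eqP; rewrite -subr_eq0 -(KlinearB (fs_sum_lin f)); apply/eqP.
    have /pker Nd : p (r t - u) = 0 by rewrite (KlinearB pl) rK pu subrr.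
    exact: Nd.
  have [D Z] := fs_sum_lin f.
  exists (fun t => fs_sum f (r t)); split; [split|].
  - by move=> u v; rewrite -D; apply: gE; rewrite pD !rK.
  - by move=> a v; rewrite -Z; apply: gE; rewrite pZ !rK.
  - by move=> v; rewrite (gE _ (fs_delta K v)) // fs_sum_delta.
move=> g1 g2 l1 l2 E t; have [w <-] := psurj t.
have C (g : T -> W) : Klinear g -> Klinear (g \o p).
  move=> [gD gZ]; split=> [u v|a v] /=; first by rewrite pD gD.
  by rewrite pZ gZ.
have := Klinear_fs (C _ l1) w; rewrite /= => ->.
have := Klinear_fs (C _ l2) w; rewrite /= => ->.
by apply: eq_bigr => x _; rewrite E.
Qed.
End ScalarExt.

(** A functional vanishing on [U] agrees with the zero map on the image of [iota], hence everywhere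
    by uniqueness; [full_subspace] concludes. *)
Lemma scalar_ext_span (k K : fieldType) (phi : {rmorphism k -> K})
    (V : lmodType k) (T : lmodType K) (iota : V -> T) (U : T -> Prop) :
  is_scalar_ext phi iota -> subspace U -> (forall v, U (iota v)) -> forall t, U t.
Proof.
move=> [_ univ] HU Ui; apply: (full_subspace HU) => f fl fU.
have zl : Klinear (fun _ : T => 0 : K^o).
  by split=> [u v|a u]; rewrite ?addr0 ?scaler0.
have [] := univ K^o (fun _ => 0); first by split=> [u v|c v]; rewrite ?addr0 ?scaler0.
by move=> _ /(_ f (fun _ => 0) fl zl) H; apply: H => v; apply: fU.
Qed.

Lemma scalar_ext_id (k : fieldType) (V : lmodType k) :
  @is_scalar_ext k k (idfun : {rmorphism k -> k}) V V id.
Proof.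
split=> // W f fl; split; first by exists f.
by move=> g1 g2 _ _ E t; apply: E.
Qed.

(** Test absolute simplicity on the trivial extension of [k] by itself. *)
Lemma abs_simple_simple (k : fieldType) (D : nuAlg k) (V : amodule D) :
  abs_simple_mod V -> simple_mod V.
Proof.
move=> H; apply: (H k _ V id (scalar_ext_id V)) => d; split=> //.
by split=> [u v|a v]; [exact: mactDr|exact: mactZr].
Qed.

(** * Sums of simple modules *)

(** Coefficients can be absorbed into the generators, so plain finite sums suffice. *)
Lemma spanned_subspace (F : fieldType) (W : lmodType F) (T : Type) (f : T -> W) :
  (forall a x, exists y, a *: f x = f y) ->
  subspace (fun w => exists s : seq T, w = \sum_(x <- s) f x).
Proof.
move=> fZ; split; first by exists [::]; rewrite big_nil.
split=> [u v [s ->] [t ->]|a v [s ->]]; first by exists (s ++ t); rewrite big_cat.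
elim: s => [|x s [t IH]]; first by exists [::]; rewrite !big_nil scaler0.
have [y E] := fZ a x.
by exists (y :: t); rewrite !big_cons scalerDr E IH.
Qed.

Lemma bilin_sumr (k : fieldType) (M N P : lmodType k) (f : M -> N -> P) x
    (T : Type) (s : seq T) (g : T -> N) :
  bilin f -> f x (\sum_(t <- s) g t) = \sum_(t <- s) f x (g t).
Proof. by move=> [_ [fD [_ fZ]]]; apply: (@Klinear_sum _ _ _ (f x)). Qed.

Lemma bilin_suml (k : fieldType) (M N P : lmodType k) (f : M -> N -> P) y
    (T : Type) (s : seq T) (g : T -> M) :
  bilin f -> f (\sum_(t <- s) g t) y = \sum_(t <- s) f (g t) y.
Proof. by move=> [fD [_ [fZ _]]]; apply: (@Klinear_sum _ _ _ (f^~ y)). Qed.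

Lemma amul_bilin (k : fieldType) (D : nuAlg k) : bilin (@amul k D).
Proof.
split; first exact: amulDl; split; first exact: amulDr.
by split; [exact: amulZl|exact: amulZr].
Qed.

Lemma mact_bilin (k : fieldType) (D : nuAlg k) (V : amodule D) : bilin (@mact k D V).
Proof.
split; first exact: mactDl; split; first exact: mactDr.
by split; [exact: mactZl|exact: mactZr].
Qed.

(** Surjectivity of [mu] on tensors, extracted from uniqueness of the factorization of the zero
    map. *)
Lemma tensor_iso_span (k : fieldType) (R : Type) (M N P : lmodType k)
    (ra : M -> R -> M) (la : R -> N -> N) (mu : M -> N -> P) :
  bilin mu -> tensor_iso ra la mu ->
  forall p, exists s : seq (M * N), p = \sum_(x <- s) mu x.1 x.2.
Proof.
move=> [muD [_ [muZ _]]] iso.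
have HU := @spanned_subspace k P (M * N)%type (fun x => mu x.1 x.2).
apply: (full_subspace (HU _)) => [a [x y]|f fl fU].
  by exists (a *: x, y); rewrite /= muZ.
have zl : Klinear (fun _ : P => 0 : k^o).
  by split=> [u v|a u]; rewrite ?addr0 ?scaler0.
have [] := iso k^o (fun _ _ => 0).
- by split; [|split; [|split]] => *; rewrite ?addr0 ?scaler0.
- by [].
move=> _ /(_ f (fun _ => 0) fl zl) H; apply: H => x y; apply: fU.
by exists [:: (x, y)]; rewrite big_seq1.
Qed.

Section SumOfSimples.
Variables (k : fieldType) (D : nuAlg k) (Q : amodule D -> Prop) (V : amodule D).
Variables (J : Type) (S : J -> amodule D) (h : forall j, S j -> V).
Hypothesis Q_S : forall j, Q (S j).
Hypothesis S_simple : forall j, simple_mod (S j).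
Hypothesis h_morph : forall j, mod_morph (@h j).
Hypothesis h_inj : forall j, injective (@h j).

Local Notation fam := {j : J & S j}.
Let hh (p : fam) : V := h (projT2 p).

Let span (A : set J) (v : V) :=
  exists s : seq fam, (forall p, List.In p s -> A (projT1 p)) /\
    v = \sum_(p <- s) hh p.

Let indep (A : set J) := forall s : seq fam,
  List.NoDup (map (@projT1 _ _) s) -> (forall p, List.In p s -> A (projT1 p)) ->
  \sum_(p <- s) hh p = 0 -> forall p, List.In p s -> projT2 p = 0.

Let h0 j : h (0 : S j) = 0.
Proof. by have [hD [hZ _]] := h_morph j; exact: (@Klinear0 _ _ _ (@h j) (conj hD hZ)). Qed.

Let span_subspace A : subspace (span A).
Proof.
split; first by exists [::]; rewrite big_nil.
split=> [u v [s [As ->]] [t [At ->]]|a v [s [As ->]]].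
  exists (s ++ t); rewrite big_cat; split=> // p ps.
  by case: (List.in_app_or _ _ _ ps) => [/As|/At].
exists (map (fun p => existT S (projT1 p) (a *: projT2 p)) s); split.
  by move=> p /List.in_map_iff [q [<- qs]]; exact: (As q qs).
rewrite big_map scaler_sumr; apply: eq_bigr => p _.
by case: (h_morph (projT1 p)) => _ [hZ _]; rewrite /hh hZ.
Qed.

Let span_act A d v : span A v -> span A (mact d v).
Proof.
move=> [s [As ->]].
exists (map (fun p => existT S (projT1 p) (mact d (projT2 p))) s); split.
  by move=> p /List.in_map_iff [q [<- qs]]; exact: (As q qs).
rewrite big_map (bilin_sumr _ _ _ (mact_bilin V)); apply: eq_bigr => p _.
by case: (h_morph (projT1 p)) => _ [_ hA]; rewrite /hh hA.
Qed.

Let chain_list (F : set (set J)) (s : seq fam) :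
  total_on F subset -> (exists A, F A) ->
  (forall p, List.In p s -> (\bigcup_(A in F) A)%classic (projT1 p)) ->
  exists2 A, F A & forall p, List.In p s -> A (projT1 p).
Proof.
move=> Ftot [A0 FA0]; elim: s => [|q s IH] Hs; first by exists A0.
have [|A FA As] := IH; first by move=> p ps; apply: Hs; right.
have [|B FB Bq] := Hs q; first by left.
have [AB|BA] := Ftot _ _ FA FB.
  by exists B => // p [<-//|/As]; apply: AB.
by exists A => // p [<-|/As //]; apply: BA.
Qed.

(** A relation involves finitely many indices, which all lie in one member of the chain by
    [chain_list]; hence independence passes to unions of chains. *)
Let max_indep : exists A, indep A /\ forall B, (A `<` B)%classic -> ~ indep B.
Proof.
apply: Zorn_bigcup => F FI Ftot s us Fs s0 p ps.
have [|A FA As] := chain_list Ftot _ Fs.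
  by have [A FA _] := Fs p ps; exists A.
exact: (FI A FA s us As s0 p ps).
Qed.

(** If the image of [S j] is not inside the span of [A], it meets that span only in 0, so [j] can be
    added to [A], against maximality. *)
Let max_spans A : indep A -> (forall B, (A `<` B)%classic -> ~ indep B) ->
  forall j (x : S j), span A (h x).
Proof.
move=> IA Amax j x; apply: contrapT => nx.
have [hD [hZ hA]] := h_morph j.
(* The preimage of the span is a submodule of the simple module [S j], and it is proper because it
   misses [x]. *)
have zero (y : S j) : span A (h y) -> y = 0.
  have [S0 [SD SZ]] := span_subspace A.
  have sub : subspace (fun y : S j => span A (h y)).
    split; first by rewrite h0.
    by split=> [u v Au Av|a v Av]; rewrite ?hD ?hZ; [apply: SD|apply: SZ].
  have [_ /(_ _ sub) H] := S_simple j.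
  have act d (z : S j) : span A (h z) -> span A (h (mact d z)).
    by rewrite hA; apply: span_act.
  by have [Z|/(_ x)] := H act; first exact: Z.
have nAj : ~ A j.
  move=> Aj; apply: nx; exists [:: existT S j x]; rewrite big_seq1; split=> //.
  by move=> p [<-|].
apply: (Amax (fun i => A i \/ i = j)).
  split; first by move=> i; left.
  by move/(_ j); apply/not_implyP; split=> //; right.
move=> s us As s0.
(* A relation without an entry at [j] is one over [A]. Otherwise the unique entry [q] at [j] is
   isolated: its image lies in the span of [A], so it vanishes. *)
have [[q [qs qj]]|nj] := EM (exists q, List.In q s /\ projT1 q = j); last first.
  apply: IA => // p ps; case: (As p ps) => // pj.
  by case: nj; exists p.
have [s1 [s2 Es]] : exists s1 s2, s = s1 ++ q :: s2 by exact: List.in_split.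
subst s.
move: us s0; rewrite map_cat /= big_cat big_cons /= addrCA => us s0.
have us12 : List.NoDup (map (@projT1 _ _) (s1 ++ s2)).
  by rewrite map_cat; exact: (List.NoDup_remove_1 _ _ _ us).
have q12 : ~ List.In (projT1 q) (map (@projT1 _ _) (s1 ++ s2)).
  by rewrite map_cat; exact: (List.NoDup_remove_2 _ _ _ us).
have A12 p : List.In p (s1 ++ s2) -> A (projT1 p).
  move=> ps; case: (As p) => [|//|pj].
    by apply/List.in_or_app; case: (List.in_app_or _ _ _ ps); [left|right; right].
  by case: q12; rewrite qj -pj; apply: List.in_map.
have q0 : projT2 q = 0.
  case: q qj {qs us us12 q12 As} s0 => j' y /= E; subst j'.
  move=> /eqP; rewrite addr_eq0 => /eqP hq; apply: zero.
  rewrite [h y]hq; apply: (subspaceN (span_subspace A)).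
  by exists (s1 ++ s2); rewrite big_cat.
move: s0; rewrite {1}/hh q0 h0 add0r -big_cat => s0 p ps.
have Z := IA _ us12 A12 s0.
case: (List.in_app_or _ _ _ ps) => [p1|[<- //|p2]].
  by apply: Z; apply/List.in_or_app; left.
by apply: Z; apply/List.in_or_app; right.
Qed.

(** The property [Q] is kept apart from simplicity: simplicity yields independence, while [Q] may be
    absolute simplicity of the summands. *)
Lemma direct_sum_of_sum :
  (forall v : V, exists s : seq fam, v = \sum_(p <- s) h (projT2 p)) ->
  direct_sum_of Q V.
Proof.
move=> hspan; have [A [IA Amax]] := max_indep.
pose I := {j : J | A j}.
pose S' (i : I) := S (sval i).
exists I, S', (fun i => @h (sval i)); split; first by move=> i; exact: Q_S.
split; first by move=> i; split; [exact: h_morph|exact: h_inj].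
split=> [v|s us s0 p ps].
  have [s Es] := hspan v.
  have : span A v.
    by rewrite Es; apply: (subspace_sum (span_subspace A)) => p _; exact: (max_spans IA Amax).
  move=> [s' [As' ->]]; elim: s' As' => [|q s' IH] As'.
    by exists [::]; rewrite !big_nil.
  have [|t IHt] := IH; first by move=> p ps; apply: As'; right.
  have Aq : A (projT1 q) by apply: As'; left.
  exists (existT S' (exist _ (projT1 q) Aq) (projT2 q) :: t).
  by rewrite !big_cons IHt.
pose g (p : {i : I & S' i}) : fam := existT S (sval (projT1 p)) (projT2 p).
have := IA (map g s) _ _ _ (g p); apply.
- rewrite -map_comp (_ : map _ s = map sval (map (@projT1 _ _) s)).
    apply: List.NoDup_map_NoDup_ForallPairs us => [[x ax] [y ay]] _ _ /= E.
    exact: eq_exist.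
  by rewrite -map_comp.
- by move=> q /List.in_map_iff [r [<- _]]; apply: (svalP (projT1 r)).
- by rewrite big_map.
- exact: List.in_map.
Qed.

End SumOfSimples.

(** * From a Morita context to absolute semisimplicity *)

Section FromMorita.
Variables (k : fieldType) (D : nuAlg k) (I : Type) (C : morita_ctx D (kI k I)).
Hypothesis D_lu : has_local_units D.
Hypothesis C_strict : strict_ctx C.

Local Notation P := (M12 C).
Local Notation Q := (M21 C).
Local Notation e_ i := (fs_delta k i : kI k I).

Let span1 d : exists s : seq (P * Q), d = \sum_(x <- s) p1 x.1 x.2.
Proof. by case: C_strict => _ [/(tensor_iso_span (p1_bilin C))]. Qed.

Let span2 f : exists s : seq (Q * P), f = \sum_(x <- s) p2 x.1 x.2.
Proof. by case: C_strict => _ [_ [/(tensor_iso_span (p2_bilin C))]]. Qed.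

Let e_mulr i (f : kI k I) : amul f (e_ i) = f i *: e_ i.
Proof.
apply: finsupp_ext => j; have -> : (f i *: e_ i) j = f i * (e_ i j) by [].
have -> : amul f (e_ i) j = f j * (e_ i j) by [].
by rewrite fs_deltaE; case: eqP => [<- //|]; rewrite !mulr0.
Qed.

Let e_idem i : amul (e_ i) (e_ i) = e_ i.
Proof. by rewrite e_mulr fs_deltaE eqxx scale1r. Qed.

Let col_subspace i : subspace (fun x : P => r12 x (e_ i) = x).
Proof.
have [rD [_ [rZ _]]] := r12_bilin C.
split; first by have := rZ 0 0 (e_ i); rewrite !scale0r.
by split=> [u v Eu Ev|a v Ev]; rewrite ?rD ?rZ ?Eu ?Ev.
Qed.

Definition column i := subsp (col_subspace i).

Let colP i (x : column i) : r12 (val x) (e_ i) = val x.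
Proof. exact: (subspP x). Qed.

Let col_actP i d (x : column i) : r12 (l12 d (val x)) (e_ i) = l12 d (val x).
Proof. by rewrite as1122 colP. Qed.

Definition col_act i d (x : column i) : column i := to_subsp (col_subspace i) (col_actP d x).

Let col_ofP i (x : P) : r12 (r12 x (e_ i)) (e_ i) = r12 x (e_ i).
Proof. by rewrite as1222 e_idem. Qed.

Let col_of i (x : P) : column i := to_subsp (col_subspace i) (col_ofP i x).

Definition column_mod (i : I) : amodule D.
Proof.
apply: (@AModule k D (column i) (@col_act i)) => *; apply: val_inj => /=;
  have [lD [lD' [lZ lZ']]] := l12_bilin C.
- exact: as1112.
- exact: lD.
- exact: lD'.
- exact: lZ.
- exact: lZ'.
Defined.

(* The rank one operators [p1 p q] on the [i]-th column: [x |-> (q x)_i p]. *)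
Let coef i (q : Q) (x : column i) : k := (p2 q (val x) : kI k I) i.

Let p2_col i q (x : column i) : p2 q (val x) = coef q x *: e_ i.
Proof. by rewrite -e_mulr as2122 colP. Qed.

Let act_p1 i (p : P) q (x : column i) :
  l12 (p1 p q) (val x) = coef q x *: val (col_of i p).
Proof.
by rewrite as1212 p2_col; have [_ [_ [_ rZ]]] := r12_bilin C; rewrite rZ.
Qed.

Let col_ofK i (x : column i) : col_of i (val x) = x.
Proof. by apply: val_inj; exact: colP. Qed.

Let coef_lin i q : Klinear (fun x : column i => coef q x : k^o).
Proof.
have [_ [pD [_ pZ]]] := p2_bilin C.
by split=> [u v|a v]; rewrite /coef ?raddfD ?linearZ /= ?pD ?pZ.
Qed.

(** Write [e_i] as a sum of products [q_b p_b]. Then [x = x e_i] is the sum of the [(x q_b) p_b], so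
    a local unit [u] for the finitely many [x q_b] fixes every [x]. Decomposing [u] itself by [p1]
    turns [u x = x] into the expansion. *)
Let dual_basis i (xs : seq (column i)) : exists s : seq (Q * column i),
  forall x, List.In x xs -> x = \sum_(b <- s) coef b.1 x *: b.2.
Proof.
have [t Et] := span2 (e_ i).
pose ds := [seq p1 (val x) b.1 | x <- xs, b <- t].
have [u [_ Hu]] := D_lu ds.
have ux x : List.In x xs -> l12 u (val x) = val x.
  move=> xxs.
  have E : r12 (val x) (e_ i) = \sum_(b <- t) r12 (val x) (p2 b.1 b.2).
    by move: (val x) => y; rewrite Et (bilin_sumr _ _ _ (r12_bilin C)).
  rewrite -[in LHS]colP -[RHS]colP E.
  rewrite (bilin_sumr _ _ _ (l12_bilin C)) big_seq [RHS]big_seq.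
  apply: eq_bigr => b bt; rewrite -as1212 -as1112; congr l12.
  apply: (Hu _ _).1; apply/allpairsP; exists (x, b); split=> //.
  exact/In_mem.
have [s Es] := span1 u.
exists [seq (b.2, col_of i b.1) | b <- s] => x /ux; rewrite {1}Es.
rewrite (bilin_suml _ _ _ (l12_bilin C)) big_map => E; apply: val_inj.
rewrite (Klinear_sum (@subsp_val_lin _ _ _ _)) -{1}E; apply: eq_bigr => b _.
exact: act_p1.
Qed.

(** Otherwise [e_i = e_i e_i], a sum of products [q_b (p_b e_i)], would vanish at [i]. *)
Let coef_nz i : exists q (x : column i), coef q x <> 0.
Proof.
apply: contrapT => H.
have Z q (x : column i) : coef q x = 0.
  by apply: contrapT => nz; apply: H; exists q, x.
have [t Et] := span2 (e_ i).
have : (e_ i : kI k I) i = 0.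
  rewrite -e_idem {1}Et (bilin_suml _ _ _ (amul_bilin _)).
  rewrite (Klinear_sum (@fs_eval_lin k I i)) big1 // => b _.
  by rewrite as2122; apply: (Z b.1 (col_of i b.2)).
by rewrite fs_deltaE eqxx => /eqP; rewrite oner_eq0.
Qed.

(** Each [coef q] extends to a functional [g q] over [K], and [p1 p q] acts by sending [w] to
    [g q w] times [iota p]. The dual bases show that a nonzero [w] has some [g q w] nonzero, so a
    submodule containing [w] contains every [iota p]. *)
Lemma column_abs_simple i : abs_simple_mod (column_mod i).
Proof.
move=> K phi T iota ext rho Hrho.
have [[iD iZ] univ] := ext.
have Hg q : exists g : T -> K^o, Klinear g /\ forall x : column i, g (iota x) = phi (coef q x).
  have [|[g Hg] _] := univ K^o (fun x => phi (coef q x)); last by exists g.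
  have [cD cZ] := coef_lin i q.
  by split=> [u v|c v]; rewrite ?cD ?cZ ?rmorphD ?rmorphM.
have [g /all_and2[gl gE]] := choice Hg.
have rhoE p q w : rho (p1 (val p) q) w = g q w *: iota p.
  have [rl rE] := Hrho (p1 (val p) q).
  have gl' : Klinear (fun w => g q w *: iota p).
    have [gD gZ] := gl q.
    by split=> [u v|a v]; rewrite ?gD ?gZ ?scalerDl ?scalerA.
  have [|_ uniq] := univ T (fun x => g q (iota x) *: iota p).
    have [gD gZ] := gl q.
    by split=> [u v|c v]; rewrite ?iD ?iZ ?gD ?gZ ?scalerDl ?scalerA.
  apply: (uniq _ _ rl gl') => x; rewrite rE gE -iZ; congr iota.
  by apply: val_inj; rewrite /= act_p1 col_ofK.
have [rD rZ] := all_and2 (fun d => (Hrho d).1).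
(* The statement is strengthened to hold for every dual basis of a suitable finite list [xs]: such
   lists can be concatenated, so the vectors [w] concerned form a subspace. *)
have recon w : exists s : seq (Q * column i), w = \sum_(b <- s) g b.1 w *: iota b.2.
  suff [xs Hxs] : exists xs : seq (column i), forall s : seq (Q * column i),
      (forall x, List.In x xs -> x = \sum_(b <- s) coef b.1 x *: b.2) ->
      w = \sum_(b <- s) g b.1 w *: iota b.2.
    by have [s Hs] := dual_basis xs; exists s; apply: Hxs.
  apply: (scalar_ext_span (U := fun w => exists xs : seq (column i), forall s : seq (Q * column i),
      (forall x, List.In x xs -> x = \sum_(b <- s) coef b.1 x *: b.2) ->
      w = \sum_(b <- s) g b.1 w *: iota b.2) ext) => [|x].
    split; first by exists [::] => s _; rewrite big1 // => b _; rewrite (Klinear0 (gl _)) scale0r.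
    split=> [u v [xs Hu] [ys Hv]|a v [xs Hv]].
      exists (xs ++ ys) => s Hs.
      have Eu := Hu s (fun x xy => Hs x (List.in_or_app xs ys x (or_introl xy))).
      have Ev := Hv s (fun x xy => Hs x (List.in_or_app xs ys x (or_intror xy))).
      rewrite {1}Eu {1}Ev -big_split; apply: eq_bigr => b _ /=.
      by have [-> _] := gl b.1; rewrite scalerDl.
    exists xs => s Hs; rewrite {1}(Hv s Hs) scaler_sumr; apply: eq_bigr => b _.
    by have [_ ->] := gl b.1; rewrite scalerA.
  exists [:: x] => s /(_ x (or_introl erefl)) Hs.
  have i0 : iota 0 = 0 by rewrite -(scale0r (0 : column i)) iZ rmorph0 scale0r.
  rewrite {1}Hs (big_morph iota iD i0); apply: eq_bigr => b _.
  by rewrite gE -iZ.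
split.
  have [q [x /eqP nz]] := coef_nz i.
  exists (p1 (val x) q), (iota x) => E.
  move: (congr1 (g q) E); rewrite rhoE (Klinear0 (gl q)).
  have [_ ->] := gl q; rewrite gE => /eqP; rewrite mulf_eq0 fmorph_eq0.
  by rewrite (negbTE nz).
move=> U HU Ust.
have [nz|Z] := EM (exists w, U w /\ w <> 0); last first.
  by left=> w Uw; apply: contrapT => w0; apply: Z; exists w.
right; have [w [Uw w0]] := nz.
have [q gq] : exists q, g q w <> 0.
  apply: contrapT => H; apply: w0; have [s ->] := recon w.
  rewrite big1 // => b _; have -> : g b.1 w = 0; last by rewrite scale0r.
  by apply: contrapT => gb; apply: H; exists b.1.
apply: (scalar_ext_span ext HU) => p.
have [_ [_ UZ]] := HU.
have := UZ (g q w)^-1 _ (Ust (p1 (val p) q) _ Uw).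
by rewrite rhoE scalerA mulVf ?scale1r //; apply/eqP.
Qed.

(** With a local unit, [d = d u]. Expanding both factors gives terms [(p q)(p' q') = (p (q p')) q'],
    and [q p'] in [k_I] is a combination of the [e_i]; so the [(p e_i) q'] span [D]. *)
Let D_gen (U : D -> Prop) : subspace U ->
  (forall i (x : column i) q, U (p1 (val x) q)) -> forall d, U d.
Proof.
move=> HU Up d.
have [u [_ Hu]] := D_lu [:: d].
have [_ du] := Hu d (mem_head _ _).
have [s Es] := span1 d; have [t Et] := span1 u.
rewrite -du Es (bilin_suml _ _ _ (amul_bilin D)).
apply: (subspace_sum HU) => x _.
rewrite Et (bilin_sumr _ _ _ (amul_bilin D)).
apply: (subspace_sum HU) => y _.
rewrite as1211 -as2121 -as1221 (fs_expand (p2 x.2 y.1)).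
rewrite (bilin_sumr _ _ _ (r12_bilin C)) (bilin_suml _ _ _ (p1_bilin C)).
apply: (subspace_sum HU) => i _.
have [_ [_ [_ rZ]]] := r12_bilin C; have [_ [_ [pZ _]]] := p1_bilin C.
rewrite rZ pZ; have [_ [_ UZ]] := HU; apply: UZ.
exact: (Up i (col_of i x.1)).
Qed.

(** The maps [h0], sending [x] in a column to [(x q) v], have images whose sum is [V]. By simplicity
    each is injective or zero; the injective ones are fed to [direct_sum_of_sum]. *)
Lemma morita_abs_semisimple : abs_semisimple_alg D.
Proof.
move=> V Vu.
pose h0 (j : I * Q * V) (x : column_mod j.1.1) : V := mact (p1 (val x) j.1.2) j.2.
have h0_morph j : mod_morph (@h0 j).
  have [pD [_ [pZ _]]] := p1_bilin C.
  split=> [u v|]; first by rewrite /h0 raddfD pD mactDl.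
  split=> [c v|d v]; first by rewrite /h0 linearZ pZ mactZl.
  by rewrite /h0 /= as1121 mactA.
pose J := {j : I * Q * V | injective (@h0 j)}.
pose S (j : J) := column_mod (sval j).1.1.
pose h (j : J) : S j -> V := @h0 (sval j).
apply: (@direct_sum_of_sum k D _ V J S h).
- by move=> j; apply: column_abs_simple.
- by move=> j; apply/abs_simple_simple/column_abs_simple.
- by move=> j; apply: h0_morph.
- by move=> j; apply: (svalP j).
pose U (v : V) := exists s : seq {j : J & S j}, v = \sum_(p <- s) h _ (projT2 p).
have HU : subspace U.
  apply: spanned_subspace => a [j x]; exists (existT S j (a *: x)) => /=.
  by have [_ [hZ _]] := h0_morph (sval j); rewrite /h hZ.
move=> v; have [s ->] := Vu v.
apply: (subspace_sum HU) => -[d w] _ /=.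
apply: (D_gen (U := fun d => U (mact d w))) => [|i x q].
  have [U0 [UD UZ]] := HU.
  split; first by have := mactZl (0 : k) (0 : D) w; rewrite !scale0r => ->.
  by split=> [a b Ua Ub|a b Ub]; rewrite ?mactDl ?mactZl; [apply: UD|apply: UZ].
have [inj|ninj] := EM (injective (@h0 (i, q, w))).
  exists [:: existT S (exist _ (i, q, w) inj) x].
  by rewrite big_seq1.
have [hD [hZ hA]] := h0_morph (i, q, w).
have hl := conj hD hZ : Klinear (@h0 (i, q, w)).
have [_ H] := abs_simple_simple (@column_abs_simple i).
have sub : subspace (fun y => @h0 (i, q, w) y = 0).
  split; first exact: (Klinear0 hl).
  by split=> [u u' Eu Eu'|a u Eu]; rewrite ?hD ?hZ ?Eu ?Eu' ?addr0 ?scaler0.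
have st d' y : @h0 (i, q, w) y = 0 -> @h0 (i, q, w) (mact d' y) = 0.
  by move=> E; rewrite hA E; have [_ [mD [_ mZ]]] := mact_bilin V;
    exact: (@Klinear0 _ _ _ (mact d')).
have [Z|Z] := H _ sub st; last by have := Z x; rewrite /h0 /= => ->; case: HU.
case: ninj => y z E; apply/eqP; rewrite -subr_eq0; apply/eqP/Z.
by rewrite (KlinearB hl) E subrr.
Qed.

End FromMorita.

(** * Morita contexts from orthogonal idempotents *)

(* If [sum x (x) y] is killed by [mu] and [x = sum_b m_b (r_b x)] with
   [(r_b x) y = h_b (mu x y)], then [sum x (x) y = sum_b m_b (x) h_b (sum mu x y) = 0]. *)
Lemma tensor_iso_local (k : fieldType) (R : Type) (M N P : lmodType k)
    (ra : M -> R -> M) (la : R -> N -> N) (mu : M -> N -> P) :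
  bilin mu ->
  (forall p, exists s : seq (M * N), p = \sum_(x <- s) mu x.1 x.2) ->
  (forall xs : seq M, exists bs : seq (M * (M -> R) * (P -> N)),
     (forall b, List.In b bs -> Klinear b.2 /\
        forall x y, la (b.1.2 x) y = b.2 (mu x y)) /\
     (forall x, x \in xs -> x = \sum_(b <- bs) ra b.1.1 (b.1.2 x))) ->
  tensor_iso ra la mu.
Proof.
move=> mub span loc W f fb bal.
have [muD [_ [muZ _]]] := mub; have [fD [_ [fZ _]]] := fb.
pose mus (s : seq (M * N)) := \sum_(x <- s) mu x.1 x.2.
pose fs (s : seq (M * N)) := \sum_(x <- s) f x.1 x.2.
pose sc (c : k) (s : seq (M * N)) := [seq (c *: x.1, x.2) | x <- s].
have musZ c s : mus (sc c s) = c *: mus s.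
  by rewrite /mus big_map scaler_sumr; apply: eq_bigr => x _; rewrite muZ.
have fsZ c s : fs (sc c s) = c *: fs s.
  by rewrite /fs big_map scaler_sumr; apply: eq_bigr => x _; rewrite fZ.
have key0 s : mus s = 0 -> fs s = 0.
  move=> s0; have [bs [Hb Hx]] := loc (map fst s).
  transitivity (\sum_(x <- s) \sum_(b <- bs) f b.1.1 (b.2 (mu x.1 x.2))).
    rewrite /fs big_seq [RHS]big_seq; apply: eq_bigr => x xs.
    rewrite {1}(Hx x.1) ?map_f // (bilin_suml _ _ _ fb).
    elim: bs Hb {Hx} => [|b bs IH] Hb; first by rewrite !big_nil.
    rewrite !big_cons IH; last by move=> b' b's; apply: Hb; right.
    by rewrite bal; have [_ ->] := Hb b (or_introl erefl).
  rewrite exchange_big /=.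
  elim: bs Hb {Hx} => [|b bs IH] Hb; first by rewrite big_nil.
  rewrite big_cons IH ?addr0; last by move=> b' b's; apply: Hb; right.
  have [bl _] := Hb b (or_introl erefl).
  rewrite -(bilin_sumr _ _ _ fb) -(Klinear_sum bl) -/(mus s) s0 (Klinear0 bl).
  by have [_ [_ [_ fZr]]] := fb; have := fZr 0 b.1.1 0; rewrite !scale0r.
(* Hence [fs] depends only on the value of [mus], and the factorization of [f] can be computed on
   any chosen decomposition [r p]. *)
have key s t : mus s = mus t -> fs s = fs t.
  move=> st; apply/eqP; rewrite -subr_eq0 -scaleN1r -fsZ /fs -big_cat; apply/eqP/key0.
  by rewrite /mus big_cat /= -!/(mus _) musZ st scaleN1r subrr.
have [r rE] := choice span.
split.
  exists (fun p => fs (r p)); split; first split.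
  - move=> u v; rewrite /fs -big_cat; apply: key.
    by rewrite /mus big_cat -!/(mus _) /mus -!rE.
  - by move=> c u; rewrite -fsZ; apply: key; rewrite musZ /mus -!rE.
  - move=> x y; transitivity (fs [:: (x, y)]); last by rewrite /fs big_seq1.
    by apply: key; rewrite /mus -rE big_seq1.
move=> g1 g2 l1 l2 E p; have [s ->] := span p.
rewrite (Klinear_sum l1) (Klinear_sum l2).
by apply: eq_bigr => x _; apply: E.
Qed.

Section OrthogonalIdempotents.
Variables (k : fieldType) (D : nuAlg k) (I : Type) (e : I -> D).
Hypothesis D_lu : has_local_units D.
Hypothesis e_idem : forall i, amul (e i) (e i) = e i.
Hypothesis e_neq0 : forall i, e i <> 0.
Hypothesis e_orth : forall i j, i <> j -> forall d, amul (amul (e i) d) (e j) = 0.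
Hypothesis e_corner : forall i d, exists c, amul (amul (e i) d) (e i) = c *: e i.
Hypothesis e_gen : forall d : D, exists s : seq (D * I * D),
  d = \sum_(x <- s) amul (amul x.1.1 (e x.1.2)) x.2.

Local Notation E := (kI k I).

Let emb : E -> D := fs_sum e.

Let emb_lin : Klinear emb.
Proof. exact: fs_sum_lin. Qed.

Let ee i j : amul (e i) (e j) = (i == j :> {classic I})%:R *: e i.
Proof.
case: eqP => [<-|ij]; first by rewrite e_idem scale1r.
by rewrite -{1}e_idem e_orth // scale0r.
Qed.

Let e_emb i f : amul (e i) (emb f) = f i *: e i.
Proof.
rewrite /emb /fs_sum (bilin_sumr _ _ _ (amul_bilin D)).
have -> : f i = fs_sum (@fs_delta k I) f i by rewrite -fs_expand.
rewrite /fs_sum (Klinear_sum (@fs_eval_lin k I i)) scaler_suml.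
apply: eq_bigr => j _; rewrite amulZr ee scalerA; congr (_ *: _).
by rewrite -fs_deltaE.
Qed.

(** The coefficient [f i] is recovered from [e_i emb f = f_i e_i]. *)
Let emb_inj : injective emb.
Proof.
move=> f g fg; apply: finsupp_ext => i.
have := e_emb i f; rewrite fg e_emb => /eqP.
rewrite -subr_eq0 -scalerBl scaler_eq0 subr_eq0 => /orP[/eqP -> //|/eqP].
by move/e_neq0.
Qed.

Let emb_delta i : emb (fs_delta k i) = e i.
Proof. exact: fs_sum_delta. Qed.

Let embM f g : emb (amul f g) = amul (emb f) (emb g).
Proof.
rewrite {2}/emb /fs_sum (bilin_suml _ _ _ (amul_bilin D)).
rewrite {1}[f]fs_expand /fs_sum (bilin_suml _ _ _ (amul_bilin E)) (Klinear_sum emb_lin).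
apply: eq_bigr => i _; rewrite !amulZl (emb_lin.2) e_emb; congr (_ *: _).
rewrite -emb_delta -(emb_lin.2); congr emb; apply: finsupp_ext => j.
have -> : amul (fs_delta k i : E) g j = fs_delta k i j * g j by [].
have -> : (g i *: fs_delta k i : E) j = g i * fs_delta k i j by [].
by rewrite fs_deltaE; case: eqP => [->|_]; rewrite ?mulr1 ?mul1r ?mulr0 ?mul0r.
Qed.

Let emb_ind (f : E) s : {subset fs_dom f <= s} -> amul (fs_ind k s : E) f = f.
Proof. exact: fs_indM. Qed.

Let emb_ind' (f : E) s : {subset fs_dom f <= s} -> amul f (fs_ind k s : E) = f.
Proof. by move=> fs; rewrite -[RHS](emb_ind fs); apply: fs_mulC. Qed.

(** Orthogonality kills the mixed terms [e_i d e_j] and [e_corner] makes the diagonal ones scalar.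
    This is what lets [p2] take values in [k_I]. *)
Let emb_corner f d g : exists h, amul (amul (emb f) d) (emb g) = emb h.
Proof.
have HU : subspace (fun x => exists h, x = emb h).
  split; first by exists 0; rewrite (Klinear0 emb_lin).
  split=> [u v [h ->] [h' ->]|a v [h ->]].
    by exists (h + h'); rewrite emb_lin.1.
  by exists (a *: h); rewrite emb_lin.2.
have [_ [_ UZ]] := HU.
rewrite {1}/emb /fs_sum !(bilin_suml _ _ _ (amul_bilin D)).
apply: (subspace_sum HU) => i _.
rewrite {1}/emb /fs_sum !(bilin_sumr _ _ _ (amul_bilin D)).
apply: (subspace_sum HU) => j _.
rewrite !amulZl amulZr; apply/UZ/UZ.
have [<-|ij] := EM (i = j); last by exists 0; rewrite e_orth // (Klinear0 emb_lin).
have [c ->] := e_corner i d.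
by exists (c *: fs_delta k i); rewrite emb_lin.2 emb_delta.
Qed.

(** The sum of the [D e_i], described by local right units in [k_I]. The indicator of a union of
    supports is a common unit for two elements, whence closure under addition. *)
Let sub12 : subspace (fun x : D => exists f, amul x (emb f) = x).
Proof.
split; first by exists 0; have := amulZl 0 (0 : D) (emb 0); rewrite !scale0r.
split=> [u v [f fu] [g gv]|a v [f fv]]; last by exists f; rewrite amulZl fv.
exists (fs_ind k (fs_dom f ++ fs_dom g)); rewrite amulDl; congr (_ + _).
  by rewrite -{1}fu amulA -embM emb_ind' ?fu // => x xf; rewrite mem_cat xf.
by rewrite -{1}gv amulA -embM emb_ind' ?gv // => x xf; rewrite mem_cat xf orbT.
Qed.

Let sub21 : subspace (fun x : D => exists f, amul (emb f) x = x).
Proof.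
split; first by exists 0; have := amulZr 0 (emb 0) (0 : D); rewrite !scale0r.
split=> [u v [f fu] [g gv]|a v [f fv]]; last by exists f; rewrite amulZr fv.
exists (fs_ind k (fs_dom f ++ fs_dom g)); rewrite amulDr; congr (_ + _).
  by rewrite -{1}fu -amulA -embM emb_ind ?fu // => x xf; rewrite mem_cat xf.
by rewrite -{1}gv -amulA -embM emb_ind ?gv // => x xf; rewrite mem_cat xf orbT.
Qed.

Let X12 := subsp sub12.
Let X21 := subsp sub21.

Let mem_l12 d (x : X12) : exists f, amul (amul d (val x)) (emb f) = amul d (val x).
Proof. by have [f fx] := subspP x; exists f; rewrite amulA fx. Qed.

Let mem_emb12 d f : exists g, amul (amul d (emb f)) (emb g) = amul d (emb f).
Proof. by exists (fs_ind k (fs_dom f)); rewrite amulA -embM emb_ind'. Qed.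

Let mem_r21 (x : X21) d : exists f, amul (emb f) (amul (val x) d) = amul (val x) d.
Proof. by have [f fx] := subspP x; exists f; rewrite -amulA fx. Qed.

Let mem_emb21 d f : exists g, amul (emb g) (amul (emb f) d) = amul (emb f) d.
Proof. by exists (fs_ind k (fs_dom f)); rewrite -amulA -embM emb_ind. Qed.

Let mem_p2 (y : X21) (x : X12) : exists h, amul (val y) (val x) = emb h.
Proof.
have [f fy] := subspP y; have [g gx] := subspP x.
have [h hE] := emb_corner f (amul (val y) (val x)) g.
by exists h; rewrite -hE !amulA gx -amulA fy.
Qed.

Let c_l12 d (x : X12) : X12 := to_subsp sub12 (mem_l12 d x).
Let c_r12 (x : X12) f : X12 := to_subsp sub12 (mem_emb12 (val x) f).
Let c_l21 f (y : X21) : X21 := to_subsp sub21 (mem_emb21 (val y) f).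
Let c_r21 (y : X21) d : X21 := to_subsp sub21 (mem_r21 y d).
Let c_p1 (x : X12) (y : X21) : D := amul (val x) (val y).
Let c_p2 (y : X21) (x : X12) : E := sval (cid (mem_p2 y x)).

Let c_p2E y x : emb (c_p2 y x) = amul (val y) (val x).
Proof. by rewrite /c_p2; case: cid. Qed.

(** All operations come from the product of [D], so after applying [val] and [emb], both injective,
    each law is associativity or bilinearity in [D]. *)
Let idem_ctx : morita_ctx D E.
Proof.
apply: (@MoritaCtx k D E X12 X21 c_l12 c_r12 c_l21 c_r21 c_p1 c_p2).
1-6: split; [|split; [|split]] => *; try apply: val_inj; try apply: emb_inj;
  rewrite /= ?emb_lin.1 ?emb_lin.2 ?c_p2E /c_p1 /= ?emb_lin.1 ?emb_lin.2;
  by rewrite ?amulDl ?amulDr ?amulZl ?amulZr.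
all: move=> *; try apply: val_inj; try apply: emb_inj;
  by rewrite /= /c_p1 /= ?embM ?c_p2E /= ?embM ?c_p2E /= ?amulA.
Defined.

(** Strictness comes from [tensor_iso_local]: if [u x = x] and [u] is a sum of products [p q], then
    [x] is the sum of the [p (q x)]. The unit [u] is a local unit of [D], or the indicator of a
    finite set in [k_I]. *)
Lemma orthogonal_idempotents_morita : morita_equiv D E.
Proof.
have Kid (V : lmodType k) : Klinear (@id V : V -> V) by [].
have unitD (d : D) : exists2 u, amul u d = d & amul d u = d.
  by have [u [_ Hu]] := D_lu [:: d]; have [] := Hu d (mem_head _ _); exists u.
have [_ [lD [_ lZ]]] := l21_bilin idem_ctx.
have [_ [rD [_ rZ]]] := r12_bilin idem_ctx.
have [_ [sD [_ sZ]]] := r21_bilin idem_ctx.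
have span_p1 d : exists s : seq (X12 * X21), d = \sum_(x <- s) c_p1 x.1 x.2.
  have [s ->] := e_gen d; elim: s => [|[[x i] y] s [t IH]].
    by exists [::]; rewrite !big_nil.
  (* By idempotence [x e_i y = (x e_i)(e_i y)], with factors in [X12] and [X21]. *)
  exists ((c_r12 (to_subsp sub12 (mem_emb12 x (fs_delta k i))) (fs_delta k i),
           to_subsp sub21 (mem_emb21 y (fs_delta k i))) :: t).
  have e2 z : amul (e i) (amul (e i) z) = amul (e i) z by rewrite -amulA e_idem.
  by rewrite !big_cons IH /c_p1 /= emb_delta !amulA !e2.
have span_p2 f : exists s : seq (X21 * X12), f = \sum_(x <- s) c_p2 x.1 x.2.
  pose u : E := fs_ind k (fs_dom f).
  (* The indicator [u] of the support is a unit for [f], so [f = (f u)(u u)]. *)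
  exists [:: (to_subsp sub21 (mem_emb21 (emb u) f),
              to_subsp sub12 (mem_emb12 (emb u) u))].
  by rewrite big_seq1; apply: emb_inj; rewrite c_p2E /= -!embM -!amulA !emb_ind'.
exists idem_ctx; split; [|split; [|split]]; apply: tensor_iso_local.
- exact: amul_bilin.
- by move=> d; have [u _ du] := unitD d; exists [:: (d, u)]; rewrite big_seq1.
- move=> xs; have [u [_ Hu]] := D_lu xs.
  exists [:: (u, id, id)]; split=> [b [<-|] //|x /Hu [ux _]].
  by rewrite big_seq1.
- exact: p1_bilin.
- exact: span_p1.
- move=> xs; have [u [_ Hu]] := D_lu (map val xs).
  have [s Es] := span_p1 u.
  exists [seq (b.1, @p2 _ _ _ idem_ctx b.2, @r21 _ _ _ idem_ctx b.2) | b <- s]; split.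
    move=> b /List.in_map_iff [[p q] [<- _]] /=; split; last first.
      by move=> x y; exact: (@as2121 _ _ _ idem_ctx).
    by split=> [u' v'|a v']; [exact: sD|exact: sZ].
  move=> x xs_x; have [ux _] := Hu _ (map_f val xs_x).
  apply: val_inj; rewrite big_map (Klinear_sum (@subsp_val_lin _ _ _ _)) -{1}ux Es.
  rewrite (bilin_suml _ _ _ (amul_bilin D)); apply: eq_bigr => b _.
  by rewrite /= c_p2E /c_p1 amulA.
- exact: p2_bilin.
- exact: span_p2.
- move=> xs; have [F HF] := choice (fun y : X21 => subspP y).
  pose u : E := fs_ind k (flatten (map (fun y => fs_dom (F y)) xs)).
  have [s Es] := span_p2 u.
  exists [seq (b.1, @p1 _ _ _ idem_ctx b.2, @r12 _ _ _ idem_ctx b.2) | b <- s]; split.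
    move=> b /List.in_map_iff [[p q] [<- _]] /=; split; last first.
      by move=> x y; exact: (@as1212 _ _ _ idem_ctx).
    by split=> [u' v'|a v']; [exact: rD|exact: rZ].
  move=> x xxs.
  have ux : amul (emb u) (val x) = val x.
    rewrite -(HF x) -amulA -embM emb_ind // => i ix; apply/flattenP.
    by exists (fs_dom (F x)) => //; apply: (map_f (fun y => fs_dom (F y))).
  apply: val_inj; rewrite big_map (Klinear_sum (@subsp_val_lin _ _ _ _)) -{1}ux Es.
  rewrite (Klinear_sum emb_lin) (bilin_suml _ _ _ (amul_bilin D)); apply: eq_bigr => b _.
  by rewrite /= c_p2E /c_p1 amulA.
- exact: amul_bilin.
- by move=> f; exists [:: (f, fs_ind k (fs_dom f))]; rewrite big_seq1 emb_ind'.
- move=> xs; pose u : E := fs_ind k (flatten (map (@fs_dom k I) xs)).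
  exists [:: (u, id, id)]; split=> [b [<-|] //|x xxs].
  rewrite big_seq1; apply/esym/emb_ind => i ix; apply/flattenP.
  by exists (fs_dom x) => //; apply: map_f.
Qed.

End OrthogonalIdempotents.

(** * From absolute semisimplicity to idempotents *)

Lemma amul0l (k : fieldType) (D : nuAlg k) (x : D) : amul 0 x = 0.
Proof. by have := amulZl 0 (0 : D) x; rewrite !scale0r. Qed.

Lemma amul0r (k : fieldType) (D : nuAlg k) (x : D) : amul x 0 = 0.
Proof. by have := amulZr 0 x (0 : D); rewrite !scale0r. Qed.

(** The last field says that the left ideal [D e] is simple: any nonzero element of it generates
    [e]. *)
Record minimal_idempotent (k : fieldType) (D : nuAlg k) (e : D) : Prop := {
  mi_neq0 : e <> 0;
  mi_idem : amul e e = e;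
  mi_simple : forall x, amul x e = x -> x <> 0 -> exists z, amul z x = e }.

Definition in_corner (k : fieldType) (D : nuAlg k) (e x : D) :=
  amul e x = x /\ amul x e = x.

(** Bundling the data with its proofs lets the field and vector space structures below depend on a
    single parameter. *)
Record corner_elt (k : fieldType) (D : nuAlg k) := CornerElt {
  ce_idem : D;
  ce_elt : D;
  ce_min : minimal_idempotent ce_idem;
  ce_in : in_corner ce_idem ce_elt }.

(* In the division ring [e D e] the bicommutant of [y] is a subfield containing
   [y] and [k e]: it replaces [k(y)] and needs no description of its elements. *)
Section Bicommutant.
Variables (k : fieldType) (D : nuAlg k) (d : corner_elt D).

Local Notation e := (ce_idem d).
Local Notation y := (ce_elt d).

Let eK : amul e e = e.
Proof. exact: mi_idem (ce_min d). Qed.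

Definition bicommutant x :=
  in_corner e x /\
  forall b, in_corner e b -> amul b y = amul y b -> amul b x = amul x b.

Lemma bicommutant_subspace : subspace bicommutant.
Proof.
split; first by split=> [|b _ _]; rewrite /in_corner ?amul0l ?amul0r.
split=> [u v [[eu ue] cu] [[ev ve] cv]|a v [[ev ve] cv]].
  split=> [|b be by_]; first by rewrite /in_corner amulDl amulDr eu ue ev ve.
  by rewrite amulDl amulDr cu // cv.
split=> [|b be by_]; first by rewrite /in_corner amulZl amulZr ev ve.
by rewrite amulZl amulZr cv.
Qed.

Lemma bicommutantM u v : bicommutant u -> bicommutant v -> bicommutant (amul u v).
Proof.
move=> [[eu ue] cu] [[ev ve] cv]; split.
  by split; [rewrite -amulA eu|rewrite amulA ve].
by move=> b be by_; rewrite -amulA cu // !amulA cv.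
Qed.

Lemma bicommutant1 : bicommutant e.
Proof. by split=> [|b [eb be] _]; [split|rewrite eb be]. Qed.

Lemma bicommutant_elt : bicommutant y.
Proof. by split; first exact: ce_in. Qed.

Lemma bicommutantC u v : bicommutant u -> bicommutant v -> amul u v = amul v u.
Proof.
move=> [inu cu] [inv cv]; apply: cv => //.
by apply/esym/cu => //; exact: ce_in.
Qed.

(** Minimality of [e] gives left inverses in the corner, which are then two-sided; whatever commutes
    with [u] commutes with its inverse. *)
Lemma bicommutantV u : bicommutant u -> u <> 0 ->
  exists2 v, bicommutant v & amul v u = e.
Proof.
have V x : in_corner e x -> x <> 0 -> exists2 v, in_corner e v & amul v x = e.
  move=> [ex xe] x0; have [z zx] := mi_simple (ce_min d) xe x0.
  exists (amul e (amul z e)); last by rewrite !amulA ex zx eK.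
  by split; rewrite -?amulA ?eK // !amulA eK.
move=> [inu cu] u0; have [v inv vu] := V _ inu u0; exists v => //.
have e0 := mi_neq0 (ce_min d).
have v0 : v <> 0 by move=> v0; apply: e0; rewrite -vu v0 amul0l.
have [w inw wv] := V _ inv v0.
have uv : amul u v = e.
  transitivity (amul w (amul (amul v u) v)); last by rewrite vu inv.1 wv.
  by rewrite -!amulA wv inu.1.
split=> // b inb bby.
have bu := cu b inb bby.
by rewrite -{1}inb.1 -vu !amulA -(amulA u) -bu !amulA uv inb.2.
Qed.

Definition bifield := subsp bicommutant_subspace.
HB.instance Definition _ := GRing.Lmodule.on bifield.

Definition bi_mul (a b : bifield) : bifield :=
  to_subsp bicommutant_subspace (bicommutantM (subspP a) (subspP b)).
Definition bi_one : bifield := to_subsp bicommutant_subspace bicommutant1.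

Lemma bi_mulA : associative bi_mul.
Proof. by move=> a b c; apply: val_inj; rewrite /= amulA. Qed.
Lemma bi_mulC : commutative bi_mul.
Proof. by move=> a b; apply: val_inj; exact: (bicommutantC (subspP a) (subspP b)). Qed.
Lemma bi_mul1 : left_id bi_one bi_mul.
Proof. by move=> a; apply: val_inj; case: (subspP a) => -[]. Qed.
Lemma bi_mulDl : left_distributive bi_mul +%R.
Proof. by move=> a b c; apply: val_inj; exact: amulDl. Qed.
Lemma bi_one_neq0 : bi_one != 0.
Proof. by apply/eqP => /(congr1 val) /=; exact: mi_neq0 (ce_min d). Qed.

HB.instance Definition _ := GRing.Zmodule_isComNzRing.Build bifield
  bi_mulA bi_mulC bi_mul1 bi_mulDl bi_one_neq0.

Lemma bi_inv_ex (a : bifield) : exists b : bifield, if a == 0 then b = 0 else b * a = 1.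
Proof.
case: eqVneq => [_|/eqP a0]; first by exists 0.
have [|v bv va] := bicommutantV (subspP a).
  by move=> E; apply: a0; exact: val_inj.
by exists (to_subsp bicommutant_subspace bv); exact: val_inj.
Qed.

Definition bi_inv a := sval (cid (bi_inv_ex a)).

Lemma bi_mulV (a : bifield) : a != 0 -> bi_inv a * a = 1.
Proof. by rewrite /bi_inv; case: cid => b /=; case: eqP. Qed.
Lemma bi_inv0 : bi_inv 0 = 0.
Proof. by rewrite /bi_inv; case: cid => b /=; rewrite eqxx. Qed.

HB.instance Definition _ := GRing.ComNzRing_isField.Build bifield bi_mulV bi_inv0.

Definition bi_in (c : k) : bifield := c *: (1 : bifield).

Lemma bi_in_zmod : zmod_morphism bi_in.
Proof. by move=> a b; rewrite /bi_in scalerBl. Qed.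
Lemma bi_in_monoid : monoid_morphism bi_in.
Proof.
split=> [|a b]; first by rewrite /bi_in scale1r.
by apply: val_inj; rewrite /= amulZl amulZr eK scalerA.
Qed.
HB.instance Definition _ := GRing.isZmodMorphism.Build k bifield bi_in bi_in_zmod.
HB.instance Definition _ := GRing.isMonoidMorphism.Build k bifield bi_in bi_in_monoid.

Lemma column_subspace : subspace (fun x : D => amul x e = x).
Proof.
split; first exact: amul0l.
by split=> [u v Eu Ev|a u Eu]; rewrite ?amulDl ?amulZl ?Eu ?Ev.
Qed.

(* [D e] as a vector space over the bicommutant, acting on the right. *)
Definition bicolumn := subsp column_subspace.
HB.instance Definition _ := GRing.Zmodule.on bicolumn.

Lemma bi_scaleP (a : bifield) (x : bicolumn) :
  amul (amul (val x) (val a)) e = amul (val x) (val a).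
Proof. by have [[_ ae] _] := subspP a; rewrite amulA ae. Qed.

Definition bi_scale (a : bifield) (x : bicolumn) : bicolumn :=
  to_subsp column_subspace (bi_scaleP a x).

Lemma bi_scaleA (a b : bifield) (x : bicolumn) :
  bi_scale a (bi_scale b x) = bi_scale (a * b) x.
Proof. by rewrite (mulrC a); apply: val_inj; rewrite /= amulA. Qed.
Lemma bi_scale1 : left_id 1 bi_scale.
Proof. by move=> x; apply: val_inj; exact: (subspP x). Qed.
Lemma bi_scaleDr : right_distributive bi_scale +%R.
Proof. by move=> a x z; apply: val_inj; exact: amulDl. Qed.
Lemma bi_scaleDl (x : bicolumn) : {morph bi_scale^~ x : a b / a + b}.
Proof. by move=> a b; apply: val_inj; exact: amulDr. Qed.

HB.instance Definition _ := GRing.Zmodule_isLmodule.Build bifield bicolumn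
  bi_scaleA bi_scale1 bi_scaleDr bi_scaleDl.

End Bicommutant.

Definition regular_mod (k : fieldType) (D : nuAlg k) : amodule D :=
  @AModule k D D (@amul k D) (@amulA k D) (@amulDl k D) (@amulDr k D)
    (@amulZl k D) (@amulZr k D).

(* Over the subfield [K] generated by [y], the map [K (x) D e -> D e],
   [a (x) s |-> s a], is injective by simplicity of [K (x) D e]; it identifies
   [1 (x) y] and [y (x) e], so [y] is a scalar multiple of [e]. *)
Lemma abs_simple_corner (k : fieldType) (D : nuAlg k) (S : amodule D)
    (f : S -> regular_mod D) (e y : D) :
  abs_simple_mod S -> mod_morph f -> minimal_idempotent e ->
  (forall x : D, amul x e = x <-> exists s, f s = x) ->
  in_corner e y -> exists c, y = c *: e.
Proof.
move=> Sabs [fD [fZ fA]] mine img iny.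
pose d := CornerElt mine iny.
pose K : fieldType := bifield d.
pose phi : {rmorphism k -> K} := @bi_in k D d.
have [T [iota ext]] := scalar_ext_exists phi S.
have [[iD iZ] univ] := ext.
have fe s : amul (f s) e = f s by apply/img; exists s.
pose fe' s : bicolumn d := to_subsp (column_subspace d) (fe s).
have [|[m [ml mE]] _] := univ (bicolumn d) fe'.
  split=> [u v|c v]; apply: val_inj.
    exact: fD.
  by rewrite /= amulZr fe; exact: fZ.
have Hrho x : exists r : T -> T, Klinear r /\ forall v, r (iota v) = iota (mact x v).
  have [|//] := univ T (fun v => iota (mact x v)).
  by split=> [u v|c v]; rewrite ?mactDr ?mactZr ?iD ?iZ.
have [rho rhoP] := choice Hrho.
have [_ H] := Sabs K phi T iota ext rho rhoP.
have lmulP x (v : bicolumn d) : amul (amul x (val v)) e = amul x (val v).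
  by rewrite amulA (subspP v).
pose lmul x (v : bicolumn d) : bicolumn d := to_subsp (column_subspace d) (lmulP x v).
have lmul_lin x : Klinear (lmul x).
  by split=> [u v|a v]; apply: val_inj; [exact: amulDr|rewrite /= amulA].
(* Both sides are [K]-linear in [t] and agree on the image of [iota]. So the kernel of [m] is a
   submodule. *)
have m_rho x t : m (rho x t) = lmul x (m t).
  have [rl rE] := rhoP x; have [mD mZ] := ml; have [lD lZ] := lmul_lin x.
  have l1 : Klinear (fun t => m (rho x t)).
    by have [rD rZ] := rl; split=> [u v|a v]; rewrite ?rD ?rZ ?mD ?mZ.
  have l2 : Klinear (fun t => lmul x (m t)).
    by split=> [u v|a v]; rewrite ?mD ?mZ ?lD ?lZ.
  have [|_ uniq] := univ (bicolumn d) (fun s => m (rho x (iota s))).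
    by have [rD rZ] := rl; split=> [u v|c v]; rewrite ?iD ?iZ ?rD ?rZ ?mD ?mZ.
  apply: (uniq _ _ l1 l2) => s.
  by rewrite rE !mE; apply: val_inj; exact: fA.
have sub : subspace (fun t => m t = 0).
  have [mD mZ] := ml; split; first exact: (Klinear0 ml).
  by split=> [u v Eu Ev|a v Ev]; rewrite ?mD ?mZ ?Eu ?Ev ?addr0 ?scaler0.
have st x t : m t = 0 -> m (rho x t) = 0.
  by rewrite m_rho => ->; exact: (Klinear0 (lmul_lin x)).
have [s0 Es0] : exists s, f s = e by apply/img; exact: mi_idem mine.
have [sy Esy] : exists s, f s = y by apply/img; exact: iny.2.
(* The kernel is not everything, since [m] maps [iota s0] to [e]. *)
have minj : forall t, m t = 0 -> t = 0.
  have [//|/(_ (iota s0))] := H _ sub st.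
  by rewrite mE => /(congr1 val) /=; rewrite Es0 => e0; case: (mi_neq0 mine).
pose Y : K := to_subsp (bicommutant_subspace d) (bicommutant_elt d).
have iy : iota sy = Y *: iota s0.
  apply/eqP; rewrite -subr_eq0; apply/eqP/minj.
  rewrite (KlinearB ml) ml.2 !mE; apply/eqP; rewrite subr_eq0; apply/eqP/val_inj.
  by rewrite /= Es0 Esy iny.1.
suff [c Ec] : exists c, sy = c *: s0 by exists c; rewrite -Esy -Es0 Ec fZ.
apply: contrapT => nc.
have line : subspace (fun s => exists c, s = c *: s0).
  split; first by exists 0; rewrite scale0r.
  split=> [u v [a ->] [b ->]|a v [b ->]]; first by exists (a + b); rewrite scalerDl.
  by exists (a * b); rewrite scalerA.
(* The extension to [K] of a functional with [l s0 = 0] and [l sy = 1] contradicts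
   [iota sy = Y *: iota s0]. *)
have [l [[lD lZ] [l0 l1]]] := separating_functional line nc.
have [|[g [gl gE]] _] := univ K^o (fun s => phi (l s)).
  by split=> [u v|c v]; rewrite ?lD ?lZ ?rmorphD ?rmorphM.
move: (gE sy); rewrite iy gl.2 gE l0; last by exists 1; rewrite scale1r.
by rewrite l1 rmorph0 rmorph1 scaler0 => /eqP; rewrite eq_sym oner_eq0.
Qed.

Definition split_idempotent (k : fieldType) (D : nuAlg k) (e : D) :=
  minimal_idempotent e /\ forall x, in_corner e x -> exists c, x = c *: e.

(** * Idempotent generators of simple left ideals *)

Section SimpleSummand.
Variables (k : fieldType) (D : nuAlg k) (J : Type) (S : J -> amodule D).
Variable f : forall j, S j -> regular_mod D.
Hypothesis D_lu : has_local_units D.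
Hypothesis S_abs : forall j, abs_simple_mod (S j).
Hypothesis f_morph : forall j, mod_morph (@f j).
Hypothesis f_inj : forall j, injective (@f j).
Hypothesis f_span : forall d : regular_mod D, exists s : seq {j : J & S j},
  d = \sum_(p <- s) f (projT2 p).

Let f_lin j : Klinear (@f j).
Proof. by have [fD [fZ _]] := f_morph j. Qed.

Let f_act j x (s : S j) : f (mact x s) = amul x (f s).
Proof. by have [_ [_ fA]] := f_morph j. Qed.

Let simple_full j (U : S j -> Prop) : subspace U ->
  (forall x s, U s -> U (mact x s)) -> (exists s, U s /\ s <> 0) -> forall s, U s.
Proof.
move=> HU Ust [s [Us s0]].
have [_ H] := abs_simple_simple (@S_abs j).
by have [Z|] := H U HU Ust; first by case: s0; apply: Z.
Qed.

(* If [x] in the left ideal [L] and [y] in some simple left ideal [L'] satisfy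
   [x y <> 0], then [L y = L'], so [y = e y] with [e] in [L]; right
   multiplication by [y] being injective on [L], [e] is idempotent. *)
Lemma simple_summand_idempotent j :
  exists e : D, split_idempotent e /\ forall s : S j, amul (f s) e = f s.
Proof.
have [[a [w0 aw]] _] := abs_simple_simple (@S_abs j).
have w_ex : exists w : S j, w <> 0 by exists (mact a w0).
have [w w_neq0] := w_ex.
have fw : f w <> 0 by rewrite -(Klinear0 (@f_lin j)) => /f_inj.
have [u [_ Hu]] := D_lu [:: f w]; have [_ wu] := Hu _ (mem_head _ _).
have [t Et] := f_span u.
(* A local unit [u] with [w u = w] is a sum of elements of simple left ideals, so [w] cannot
   annihilate all of them. *)
have [i [y0 wy]] : exists i (y : S i), amul (f w) (f y) <> 0.
  apply: contrapT => H; apply: fw; rewrite -wu Et.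
  rewrite (bilin_sumr _ _ _ (amul_bilin D)) big1 // => p _.
  by apply: contrapT => nz; apply: H; exists (projT1 p), (projT2 p).
pose y : D := f y0.
have y_inj (s : S j) : amul (f s) y = 0 -> s = 0.
  move=> sy; apply: contrapT => s0; apply: wy.
  apply: (@simple_full j (fun s => amul (f s) y = 0)); last by exists s.
    have [fD fZ] := @f_lin j; split; first by rewrite (Klinear0 (@f_lin j)) amul0l.
    split=> [v v' Ev Ev'|c v Ev]; first by rewrite fD amulDl Ev Ev' addr0.
    by rewrite fZ amulZl Ev scaler0.
  by move=> x v Ev; rewrite f_act amulA Ev amul0r.
have [s0 Es0] : exists s : S j, amul (f s) y = y.
  apply: (@simple_full i (fun t => exists s : S j, amul (f s) y = f t)).
  - have [fD fZ] := @f_lin i; have [gD gZ] := @f_lin j.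
    split; first by exists 0; rewrite !(Klinear0 (@f_lin _)) amul0l.
    split=> [v v' [s Es] [s' Es']|c v [s Es]].
      by exists (s + s'); rewrite gD amulDl Es Es' fD.
    by exists (c *: s); rewrite gZ amulZl Es fZ.
  - by move=> x v [s Es]; exists (mact x s); rewrite !f_act amulA Es.
  - exists (mact (f w : D) y0); split; first by exists w; rewrite f_act.
    by move=> E; apply: wy; rewrite -f_act E (Klinear0 (@f_lin i)).
pose e : D := f s0.
(* Since [e y = y], right multiplication by [y] kills [f s e - f s], which is therefore 0.
   Idempotence is the case [s = s0]. *)
have fe (s : S j) : amul (f s) e = f s.
  apply/eqP; rewrite -subr_eq0 -f_act -(KlinearB (@f_lin j)).
  rewrite (y_inj (mact (f s : D) s0 - s)) ?(Klinear0 (@f_lin j)) //.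
  rewrite (KlinearB (@f_lin j)) f_act -scaleN1r amulDl amulZl amulA -/e Es0.
  by rewrite scaleN1r subrr.
have e0 : e <> 0 by move=> e0; apply: wy; rewrite -/y -Es0 -/e e0 amul0l amul0r.
have mine : minimal_idempotent e.
  split=> // [|x xe x0]; first exact: fe.
  have xs : f (mact x s0) = x by rewrite f_act.
  apply: (@simple_full j (fun s => exists z, amul z x = f s)).
  - have [fD fZ] := @f_lin j; split; first by exists 0; rewrite amul0l (Klinear0 (@f_lin j)).
    split=> [v v' [z Ez] [z' Ez']|c v [z Ez]].
      by exists (z + z'); rewrite amulDl Ez Ez' fD.
    by exists (c *: z); rewrite amulZl Ez fZ.
  - by move=> z v [z' Ez]; exists (amul z z'); rewrite amulA Ez f_act.
  have [v [_ Hv]] := D_lu [:: x]; have [vx _] := Hv _ (mem_head _ _).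
  exists (mact x s0); split; first by exists v; rewrite vx xs.
  by move=> E; apply: x0; rewrite -xs E (Klinear0 (@f_lin j)).
exists e; split=> //; split=> // x inx.
apply: (abs_simple_corner (@S_abs j) (f_morph j) mine _ inx) => z; split.
  by move=> ze; exists (mact z s0); rewrite f_act.
by move=> [s <-]; exact: fe.
Qed.

End SimpleSummand.

(** * Isomorphism classes of split idempotents *)

Section Representatives.
Variables (k : fieldType) (D : nuAlg k).

(** For split idempotents, [e D f] being nonzero means that the simple modules [D e] and [D f] are
    isomorphic. *)
Definition idem_rel (e f : D) := exists d, amul (amul e d) f <> 0.

(** Minimality of [f] provides a left inverse [b] of a nonzero [a] in [e D f]. Then [a b = c e] as
    [e] is split, and [(a b) a = a] forces [c = 1]. *)
Lemma idem_rel_iso e f : split_idempotent e -> split_idempotent f -> idem_rel e f ->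
  exists a b, [/\ amul a b = e, amul b a = f, amul b e = b & amul f b = b].
Proof.
move=> [mine ce] [minf _] [d0 Ed]; pose a := amul (amul e d0) f.
have ea : amul e a = a by rewrite /a -!amulA (mi_idem mine).
have af : amul a f = a by rewrite /a !amulA (mi_idem minf).
have [z za] := mi_simple minf af Ed.
pose b := amul (amul f z) e; exists a, b.
have ba : amul b a = f by rewrite /b !amulA ea za (mi_idem minf).
have be : amul b e = b by rewrite /b !amulA (mi_idem mine).
have fb : amul f b = b by rewrite /b -!amulA (mi_idem minf).
split=> //; have [|c Ec] := ce (amul a b); first by split; [rewrite -amulA ea|rewrite amulA be].
have : amul (amul a b) a = a by rewrite amulA ba af.
rewrite Ec amulZl ea => /eqP; rewrite -subr_eq0 -[X in _ - X]scale1r -scalerBl scaler_eq0.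
by rewrite subr_eq0 => /orP[/eqP ->|/eqP /Ed //]; rewrite scale1r.
Qed.

Lemma idem_rel_sym e f : split_idempotent e -> split_idempotent f ->
  idem_rel e f -> idem_rel f e.
Proof.
move=> se sf ef; have [a [b [ab ba be fb]]] := idem_rel_iso se sf ef.
exists b; rewrite fb be => b0; apply: (mi_neq0 se.1).
by rewrite -ab b0 amul0r.
Qed.

Lemma idem_rel_trans e f g : split_idempotent e -> split_idempotent f ->
  split_idempotent g -> idem_rel e f -> idem_rel f g -> idem_rel e g.
Proof.
move=> se sf sg ef fg.
have [a [b [ab ba be fb]]] := idem_rel_iso se sf ef.
have [c [d [cd dc df gd]]] := idem_rel_iso sf sg fg.
exists (amul a c) => E; apply: (mi_neq0 se.1).
have <- : amul (amul (amul (amul e (amul a c)) g) d) b = e; last by rewrite E !amul0l.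
rewrite !amulA -(amulA g) gd -(amulA c) cd fb ab; exact: mi_idem se.1.
Qed.

(** The choice is made from the class as a set, so related split idempotents get the same
    representative; for a split [e] the class contains [e], so the default 0 does not arise. *)
Definition idem_rep (e : D) : D :=
  xget 0 [set f | split_idempotent f /\ idem_rel f e].

Lemma idem_repP e : split_idempotent e ->
  split_idempotent (idem_rep e) /\ idem_rel (idem_rep e) e.
Proof.
move=> se; rewrite /idem_rep; case: xgetP => [f _ //|/(_ e)] [].
by split=> //; exists e; rewrite !(mi_idem se.1); exact: mi_neq0 se.1.
Qed.

Lemma idem_rep_eq e f : split_idempotent e -> split_idempotent f ->
  idem_rel e f -> idem_rep e = idem_rep f.
Proof.
move=> se sf ef; rewrite /idem_rep; congr (xget 0); apply/funext => g; apply/propext.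
split=> -[sg ge]; split=> //; first exact: (idem_rel_trans sg se sf).
by apply: (idem_rel_trans sg sf se) => //; apply: idem_rel_sym.
Qed.

Definition idem_class := {e : D | split_idempotent e /\ idem_rep e = e}.

Lemma idem_class_orth (i j : idem_class) : i <> j ->
  forall d, amul (amul (sval i) d) (sval j) = 0.
Proof.
move=> ij d; apply: contrapT => nz; apply: ij.
case: i j nz => e [se re] [f [sf rf]] /= nz; apply: eq_exist.
by rewrite -re -rf; apply: idem_rep_eq => //; exists d.
Qed.

Lemma idem_class_cover e : split_idempotent e ->
  exists (i : idem_class) a b, e = amul (amul a (sval i)) b.
Proof.
move=> se; have [sr re] := idem_repP se.
have rr : idem_rep (idem_rep e) = idem_rep e by apply: idem_rep_eq.
have [a [b [ab ba be fb]]] := idem_rel_iso sr se re.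
pose i : idem_class := exist _ (idem_rep e) (conj sr rr).
by exists i, b, a; rewrite /= be ba.
Qed.

End Representatives.

(** Local units make the regular module unital, so it decomposes. An element [x] of a simple summand
    equals [x e], and [e = a e_i b] for a representative [e_i], whence [x = (x a) e_i b]. *)
Lemma abs_semisimple_morita (k : fieldType) (D : nuAlg k) :
  has_local_units D -> abs_semisimple_alg D -> exists I : Type, morita_equiv D (kI k I).
Proof.
move=> lu abs.
have [|J [S [f [Sabs [Hf [f_span _]]]]]] := abs (regular_mod D).
  move=> d; have [u [_ Hu]] := lu [:: d]; have [ud _] := Hu d (mem_head _ _).
  by exists [:: (u, d)]; rewrite big_seq1.
have [f_morph f_inj] := all_and2 Hf.
exists (idem_class D).
apply: (@orthogonal_idempotents_morita k D (idem_class D) sval lu).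
- by move=> [e He] /=; exact: mi_idem He.1.1.
- by move=> [e He] /=; exact: mi_neq0 He.1.1.
- exact: idem_class_orth.
- move=> [e /= He] d; have [[mine ce] _] := He; apply: ce.
  by split; rewrite -?amulA ?(mi_idem mine) // !amulA (mi_idem mine).
move=> d; have [s ->] := f_span d.
elim: s => [|p s [t IH]]; first by exists [::]; rewrite !big_nil.
have [e [se fe]] := simple_summand_idempotent lu Sabs f_morph f_inj f_span (projT1 p).
have [i [a [b Eab]]] := idem_class_cover se.
exists ((amul (f _ (projT2 p)) a, i, b) :: t); rewrite !big_cons IH; congr (_ + _).
by rewrite /= -{1}fe Eab !amulA.
Qed.

Theorem mainTheorem1 (k : fieldType) (D : nuAlg k) :
  has_local_units D ->
  (abs_semisimple_alg D <-> exists I : Type, morita_equiv D (kI k I)).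
Proof.
move=> lu; split; first exact: abs_semisimple_morita.
by move=> [I [C C_strict]]; exact: morita_abs_semisimple lu C_strict.
Qed.
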